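(* Let $\mathbf{s}=s_1\cdots s_N\in\mathcal{S}(m|n)$ and let $V_{\mathbf{s}}(\Lambda)$ be the irreducible highest weight representation of $\mathrm{U}_q(\mathfrak{g}_{\mathbf{s}})$ with highest weight $\Lambda=(\lambda_1,\dots,\lambda_N)$, $\lambda_j=q_j^{\Lambda_j}$. If $\mathbf{s}$ has a subsequence $s_is_{i+1}=01$ or $10$ and $\Lambda_i+\Lambda_{i+1}\neq0$, then the representation $V_{\mathbf{s}}(\Lambda)$ of $\mathrm{U}_q(\mathfrak{g}_{\mathbf{s}})$ is isomorphic to the representation $V_{\sigma_i\mathbf{s}}(\Lambda^{[i]})$ of $\mathrm{U}_q(\mathfrak{g}_{\sigma_i\mathbf{s}})$, where $$\Lambda^{[i]}=\big(q_1^{\Lambda_1},\dots,q_{i-1}^{\Lambda_{i-1}},\,q_{i+1}^{\Lambda_{i+1}+1},\,q_i^{\Lambda_i-1},\,q_{i+2}^{\Lambda_{i+2}},\dots,q_N^{\Lambda_N}\big).$$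
   Context: Everything is over $\mathbb{C}$; $q\in\mathbb{C}\setminus\{0\}$ is not a root of unity (complex powers of $q$ are taken with respect to a fixed $\log q$); $m,n\in\mathbb{Z}_{\ge0}$, $N=m+n\ge2$. $\mathcal{S}(m|n)$ is the set of sequences $\mathbf{s}=s_1\cdots s_N$ with exactly $m$ zeros and $n$ ones. Given $\mathbf{s}$: $|i|=\bar0$, $d_i=1$ if $s_i=0$, and $|i|=\bar1$, $d_i=-1$ if $s_i=1$; $q_i=q^{d_i}$ (the $q_j$ in the formula for $\Lambda^{[i]}$ are those attached to $\mathbf{s}$). $\sigma_i\mathbf{s}$ is $\mathbf{s}$ with $s_i,s_{i+1}$ interchanged. Let $(\varepsilon_i|\varepsilon_j)=d_i\delta_{ij}$, $\alpha_i=\varepsilon_i-\varepsilon_{i+1}$; $[X,Y]_a=XY-(-1)^{|X||Y|}aYX$, $[X,Y]=[X,Y]_1$. $\mathrm{U}_q(\mathfrak{g}_{\mathbf{s}})$ is the quantum general linear superalgebra, given here in Drinfeld–Jimbo form: generators $x_i^\pm$ ($1\le i\le N-1$, parity $|i|+|i+1|$), $k_a^{\pm1}$ ($1\le a\le N$, even), relations: $k_ak_a^{-1}=1=k_a^{-1}k_a$, $k_ak_b=k_bk_a$; $k_ax_i^\pm k_a^{-1}=q^{\pm(\varepsilon_a|\alpha_i)}x_i^\pm$; $[x_i^+,x_j^-]=\delta_{ij}\frac{k_ik_{i+1}^{-1}-k_i^{-1}k_{i+1}}{q_i-q_i^{-1}}$; $[x_i^\pm,x_j^\pm]=0$ if $(\alpha_i|\alpha_j)=0$;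 $[x_i^\pm,[x_i^\pm,x_\ell^\pm]_{q_i}]_{q_i^{-1}}=0$ if $(\alpha_i|\alpha_i)\ne0$, $\ell=i\pm1$; $[[[x_{i-1}^\pm,x_i^\pm]_{q_i},x_{i+1}^\pm]_{q_{i+1}},x_i^\pm]=0$ if $(\alpha_i|\alpha_i)=0$. (It is identified with the RTT presentation by $\bar t_{i,i+1}=(q_i-q_i^{-1})x_i^+k_i$, $t_{i+1,i}=-(q_i-q_i^{-1})k_i^{-1}x_i^-$, $\bar t_{aa}=t_{aa}^{-1}=k_a$.) A highest weight representation with highest weight $\Lambda=(\lambda_1,\dots,\lambda_N)\in(\mathbb{C}\setminus\{0\})^N$ is one generated by a nonzero vector $\zeta$ (the maximal vector) with $x_i^+\zeta=0$ for all $i$ (equivalently $\bar t_{ij}\zeta=0$ for all $i<j$) and $k_a\zeta=\lambda_a\zeta$ for all $a$; $V_{\mathbf{s}}(\Lambda)$ denotes the irreducible one. Without loss of generality the weight is normalised as $\lambda_j=q_j^{\Lambda_j}$. Modules over $\mathrm{U}_q(\mathfrak{g}_{\mathbf{s}})$ and $\mathrm{U}_q(\mathfrak{g}_{\sigma_i\mathbf{s}})$ are compared through the odd reflection $\beta_{i,\mathbf{s}}$: for $s_i\ne s_{i+1}$, $\mathbf{s}'=\sigma_i\mathbf{s}$, $d_j'=(-1)^{s_j'}$, it is the isomorphism $\beta_{i,\mathbf{s}}:\mathrm{U}_q(\mathfrak{g}_{\mathbf{s}})\to\mathrm{U}_q(\mathfrak{g}_{\mathbf{s}'})$ given (right-hand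 sides in $\mathrm{U}_q(\mathfrak{g}_{\mathbf{s}'})$) by $k_i\mapsto d_i'k_{i+1}$, $k_{i+1}\mapsto d_{i+1}'k_i$, $k_a\mapsto k_a$ ($a\ne i,i+1$); $x_i^+\mapsto-d_{i+1}'x_i^-k_ik_{i+1}^{-1}$, $x_i^-\mapsto-d_i'k_{i+1}k_i^{-1}x_i^+$; $x_{i-1}^+\mapsto d_i'q^{-d_i'}[x_{i-1}^+,x_i^+]_{q^{d_i'}}$, $x_{i-1}^-\mapsto q^{d_i'}[x_i^-,x_{i-1}^-]_{q^{-d_i'}}$; $x_{i+1}^+\mapsto-d_{i+1}'[x_i^+,x_{i+1}^+]_{q^{-d_{i+1}'}}$, $x_{i+1}^-\mapsto-[x_{i+1}^-,x_i^-]_{q^{d_{i+1}'}}$; $x_r^\pm\mapsto x_r^\pm$ for $r\ne i,i\pm1$.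
   Formalization: Modules are compared through β_{i,s} composed with the sign automorphism removing the signs d'_i, d'_{i+1} that β puts on the k's (along β itself the claim fails), and q^{2(Λ_i+Λ_{i+1})}=1 is assumed to force Λ_i+Λ_{i+1}=0 (otherwise the claim fails). *)

(* Defs.v *)
From HB Require Import structures.
From mathcomp Require Import all_boot all_order all_algebra.
From mathcomp Require Import perm generic_quotient.
From mathcomp Require Import boolp reals sequences exp trigo.
From mathcomp.real_closed Require Import complex.

Set Implicit Arguments.
Unset Strict Implicit.
Unset Printing Implicit Defensive.

Import Order.TTheory GRing.Theory Num.Theory.
Local Open Scope ring_scope.
Local Open Scope quotient_scope.

(* Noncommutative polynomial expressions over K in the letters G: the free
   algebra K<G>, before the algebra axioms are imposed by [alg_eq] below. *)
Inductive expr (K G : Type) : Type :=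
| EGen of G
| EConst of K
| EAdd of expr K G & expr K G
| EMul of expr K G & expr K G.
Arguments EGen {K G}.
Arguments EConst {K G} c%_ring_scope : rename.

Declare Scope expr_scope.
Delimit Scope expr_scope with nc.
Bind Scope expr_scope with expr.
Notation "x + y" := (EAdd x y) : expr_scope.
Notation "x * y" := (EMul x y) : expr_scope.
Notation "c *: x" := (EMul (EConst c) x) : expr_scope.
Notation "x - y" := (EAdd x (EMul (EConst (-1)%R) y)) : expr_scope.

(* The algebra morphism of free algebras that extends b. *)
Fixpoint esubst (K G H : Type) (b : G -> expr K H) (e : expr K G) : expr K H :=
  match e with
  | EGen g => b g
  | EConst c => EConst c
  | EAdd x y => EAdd (esubst b x) (esubst b y)
  | EMul x y => EMul (esubst b x) (esubst b y)
  end.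

Section PresentedAlgebra.
Variables (K : comNzRingType) (G : Type) (rel : expr K G -> expr K G -> Prop).
Implicit Types x y z : expr K G.

Inductive alg_eq : expr K G -> expr K G -> Prop :=
| alg_rel x y : rel x y -> alg_eq x y
| alg_refl x : alg_eq x x
| alg_sym x y : alg_eq x y -> alg_eq y x
| alg_trans x y z : alg_eq x y -> alg_eq y z -> alg_eq x z
| alg_congD x x' y y' :
    alg_eq x x' -> alg_eq y y' -> alg_eq (x + y)%nc (x' + y')%nc
| alg_congM x x' y y' :
    alg_eq x x' -> alg_eq y y' -> alg_eq (x * y)%nc (x' * y')%nc
| alg_addA x y z : alg_eq (x + (y + z))%nc (x + y + z)%nc
| alg_addC x y : alg_eq (x + y)%nc (y + x)%nc
| alg_add0 x : alg_eq (EConst 0 + x)%nc x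
| alg_addN x : alg_eq ((-1) *: x + x)%nc (EConst 0)
| alg_mulA x y z : alg_eq (x * (y * z))%nc (x * y * z)%nc
| alg_mul1 x : alg_eq (EConst 1 * x)%nc x
| alg_mulDl x y z : alg_eq ((x + y) * z)%nc (x * z + y * z)%nc
| alg_mulDr x y z : alg_eq (x * (y + z))%nc (x * y + x * z)%nc
| alg_constD (a b : K) : alg_eq (EConst (a + b)) (EConst a + EConst b)%nc
| alg_constM (a b : K) : alg_eq (EConst (a * b)) (EConst a * EConst b)%nc
| alg_constC (a : K) x : alg_eq (EConst a * x)%nc (x * EConst a)%nc.

HB.instance Definition _ := gen_eqMixin (expr K G).
HB.instance Definition _ := gen_choiceMixin (expr K G).

Definition alg_eqb x y : bool := `[< alg_eq x y >].

Lemma alg_eqb_refl : reflexive alg_eqb.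
Proof. by move=> x; apply/asboolP/alg_refl. Qed.

Lemma alg_eqb_sym : symmetric alg_eqb.
Proof. by move=> x y; apply/asboolP/asboolP; apply: alg_sym. Qed.

Lemma alg_eqb_trans : transitive alg_eqb.
Proof.
by move=> y x z /asboolP xy /asboolP yz; apply/asboolP/(alg_trans xy yz).
Qed.

Canonical alg_equiv := EquivRel alg_eqb alg_eqb_refl alg_eqb_sym alg_eqb_trans.

(* The K-algebra with generators G and relations rel. *)
Definition presented := {eq_quot alg_equiv}.

HB.instance Definition _ := Choice.on presented.
HB.instance Definition _ := EqQuotient.on presented.

Definition ppi (x : expr K G) : presented := \pi_presented x.

Lemma ppi_eqP x y : ppi x = ppi y <-> alg_eq x y.
Proof.
by split=> [/eqmodP/asboolP|xy] //; apply/eqmodP/asboolP.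
Qed.

Lemma ppi_repr (u : presented) : ppi (repr u) = u.
Proof. exact: reprK. Qed.

Lemma alg_repr x : alg_eq (repr (ppi x)) x.
Proof. by apply/ppi_eqP; rewrite ppi_repr. Qed.

Definition padd (u v : presented) := ppi (repr u + repr v)%nc.
Definition pmul (u v : presented) := ppi (repr u * repr v)%nc.
Definition popp (u : presented) := ppi ((-1) *: repr u)%nc.
Definition pscale (c : K) (u : presented) := ppi (c *: repr u)%nc.

Lemma paddE x y : padd (ppi x) (ppi y) = ppi (x + y)%nc.
Proof. by apply/ppi_eqP/alg_congD; apply: alg_repr. Qed.

Lemma pmulE x y : pmul (ppi x) (ppi y) = ppi (x * y)%nc.
Proof. by apply/ppi_eqP/alg_congM; apply: alg_repr. Qed.

Lemma poppE x : popp (ppi x) = ppi ((-1) *: x)%nc.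
Proof. by apply/ppi_eqP/alg_congM; [apply: alg_refl|apply: alg_repr]. Qed.

Lemma pscaleE c x : pscale c (ppi x) = ppi (c *: x)%nc.
Proof. by apply/ppi_eqP/alg_congM; [apply: alg_refl|apply: alg_repr]. Qed.

Lemma padd_A : associative padd.
Proof.
move=> u v w; rewrite -[u]ppi_repr -[v]ppi_repr -[w]ppi_repr !paddE.
exact/ppi_eqP/alg_addA.
Qed.

Lemma padd_C : commutative padd.
Proof.
move=> u v; rewrite -[u]ppi_repr -[v]ppi_repr !paddE.
exact/ppi_eqP/alg_addC.
Qed.

Lemma padd_0 : left_id (ppi (EConst 0)) padd.
Proof. by move=> u; rewrite -[u]ppi_repr paddE; apply/ppi_eqP/alg_add0. Qed.

Lemma padd_N : left_inverse (ppi (EConst 0)) popp padd.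
Proof.
by move=> u; rewrite -[u]ppi_repr poppE paddE; apply/ppi_eqP/alg_addN.
Qed.

HB.instance Definition _ :=
  GRing.isZmodule.Build presented padd_A padd_C padd_0 padd_N.

Lemma pmul_A : associative pmul.
Proof.
move=> u v w; rewrite -[u]ppi_repr -[v]ppi_repr -[w]ppi_repr !pmulE.
exact/ppi_eqP/alg_mulA.
Qed.

Lemma pmul_1l : left_id (ppi (EConst 1)) pmul.
Proof. by move=> u; rewrite -[u]ppi_repr pmulE; apply/ppi_eqP/alg_mul1. Qed.

Lemma pmul_1r : right_id (ppi (EConst 1)) pmul.
Proof.
move=> u; rewrite -[u]ppi_repr pmulE; apply/ppi_eqP.
exact: alg_trans (alg_sym (alg_constC _ _)) (alg_mul1 _).
Qed.

Lemma pmul_Dl : left_distributive pmul padd.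
Proof.
move=> u v w; rewrite -[u]ppi_repr -[v]ppi_repr -[w]ppi_repr.
by rewrite !(paddE, pmulE); apply/ppi_eqP/alg_mulDl.
Qed.

Lemma pmul_Dr : right_distributive pmul padd.
Proof.
move=> u v w; rewrite -[u]ppi_repr -[v]ppi_repr -[w]ppi_repr.
by rewrite !(paddE, pmulE); apply/ppi_eqP/alg_mulDr.
Qed.

HB.instance Definition _ := GRing.Zmodule_isPzRing.Build presented
  pmul_A pmul_1l pmul_1r pmul_Dl pmul_Dr.

Lemma pscale_A a b u : pscale a (pscale b u) = pscale (a * b) u.
Proof.
rewrite -[u]ppi_repr !pscaleE; apply/ppi_eqP.
apply: alg_trans (alg_mulA _ _ _) _; apply: alg_congM; last exact: alg_refl.
exact/alg_sym/alg_constM.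
Qed.

Lemma pscale_1 : left_id 1 pscale.
Proof. by move=> u; rewrite -[u]ppi_repr pscaleE; apply/ppi_eqP/alg_mul1. Qed.

Lemma pscale_Dr : right_distributive pscale +%R.
Proof.
move=> a u v; rewrite -[u]ppi_repr -[v]ppi_repr.
by rewrite /GRing.add /= !(paddE, pscaleE); apply/ppi_eqP/alg_mulDr.
Qed.

Lemma pscale_Dl u : {morph pscale^~ u : a b / a + b}.
Proof.
move=> a b; rewrite -[u]ppi_repr [RHS]/GRing.add /= !pscaleE paddE.
apply/ppi_eqP; apply: alg_trans (alg_mulDl _ _ _).
by apply: alg_congM; [apply: alg_constD | apply: alg_refl].
Qed.

HB.instance Definition _ := GRing.Zmodule_isLmodule.Build K presented
  pscale_A pscale_1 pscale_Dr pscale_Dl.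

Lemma ppiD x y : ppi (x + y)%nc = ppi x + ppi y.
Proof. by rewrite -paddE. Qed.

Lemma ppiM x y : ppi (x * y)%nc = ppi x * ppi y.
Proof. by rewrite -pmulE. Qed.

Lemma ppiC c : ppi (EConst c) = c *: (1 : presented).
Proof.
rewrite [RHS]pscaleE; apply/ppi_eqP.
exact: alg_sym (alg_trans (alg_sym (alg_constC _ _)) (alg_mul1 _)).
Qed.

Lemma presented_scaleAl c (u v : presented) : c *: (u * v) = (c *: u) * v.
Proof.
rewrite -[u]ppi_repr -[v]ppi_repr /GRing.scale /GRing.mul /=.
by rewrite !(pmulE, pscaleE); apply/ppi_eqP/alg_mulA.
Qed.

Lemma presented_scaleAr c (u v : presented) : c *: (u * v) = u * (c *: v).
Proof.
rewrite -[u]ppi_repr -[v]ppi_repr /GRing.scale /GRing.mul /=.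
rewrite !(pmulE, pscaleE); apply/ppi_eqP.
apply: alg_trans (alg_mulA _ _ _) _.
apply: alg_trans (alg_congM (alg_constC _ _) (alg_refl _)) _.
exact/alg_sym/alg_mulA.
Qed.

(* An augmentation, i.e. an evaluation of the letters in K that satisfies the
   relations, shows that the presented algebra is not zero. *)
Fixpoint eeval (b : G -> K) x : K :=
  match x with
  | EGen g => b g
  | EConst c => c
  | EAdd x y => eeval b x + eeval b y
  | EMul x y => eeval b x * eeval b y
  end.

Lemma presented_neq0 (b : G -> K) :
  (forall x y, rel x y -> eeval b x = eeval b y) -> (1 : presented) != 0.
Proof.
move=> bP; apply/eqP => /ppi_eqP e10.
suff evP x y : alg_eq x y -> eeval b x = eeval b y.
  by have /eqP := evP _ _ e10; rewrite /= oner_eq0.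
elim=> //= {x y e10}.
- by move=> x y z _ -> _ ->.
- by move=> x x' y y' _ -> _ ->.
- by move=> x x' y y' _ -> _ ->.
- by move=> x y z; rewrite addrA.
- by move=> x y; rewrite addrC.
- by move=> x; rewrite add0r.
- by move=> x; rewrite mulN1r addNr.
- by move=> x y z; rewrite mulrA.
- by move=> x; rewrite mul1r.
- by move=> x y z; rewrite mulrDl.
- by move=> x y z; rewrite mulrDr.
- by move=> a x; rewrite mulrC.
Qed.

End PresentedAlgebra.

Section QuantumSuperalgebra.
Variables (K : fieldType) (q : K).

(* Letters x_i^+, x_i^- (true is +) and k_a, k_a^{-1} (true is k_a). Indices
   start at 0: x_i joins the positions lo i = i and hi i = i + 1. *)
Inductive qgen (N : nat) : Type :=
| GX of bool & 'I_N.-1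
| GK of bool & 'I_N.

Section Data.
Variable N : nat.
Implicit Types (i j l : 'I_N.-1) (a b : 'I_N) (e : bool).

Lemma hi_subproof i : (i.+1 < N)%N.
Proof. by case: N i => [[]|[[]|n] i] //=; rewrite ltnS. Qed.

Definition lo i : 'I_N := widen_ord (leq_pred N) i.
Definition hi i : 'I_N := Ordinal (hi_subproof i).

Definition swap (s : N.-tuple bool) i : N.-tuple bool :=
  [tuple tnth s (tperm (lo i) (hi i) a) | a < N].

Variable s : N.-tuple bool.

Definition sg e : int := if e then 1 else -1.

Definition dsg a : int := (-1) ^+ tnth s a.

Definition qa a : K := q ^ dsg a.

Definition form (u v : 'rV[int]_N) : int := \sum_a dsg a * u 0 a * v 0 a.
Definition eps a : 'rV[int]_N := delta_mx 0 a.
Definition alpha i : 'rV[int]_N := eps (lo i) - eps (hi i).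

Notation uexpr := (expr K (qgen N)).

(* Expressions with their parity, which the superbrackets need. *)
Definition hexpr := (uexpr * bool)%type.

(* [X, Y]_c = X Y - (-1)^{|X||Y|} c Y X *)
Definition sbr (c : K) (X Y : hexpr) : hexpr :=
  ((X.1 * Y.1 - ((-1) ^+ (X.2 && Y.2) * c) *: (Y.1 * X.1))%nc, X.2 (+) Y.2).

Definition xe e i : uexpr := EGen (GX e i).
Definition ke e a : uexpr := EGen (GK e a).
Definition hx e i : hexpr := (xe e i, tnth s (lo i) (+) tnth s (hi i)).

Inductive uq_rel : uexpr -> uexpr -> Prop :=
| uq_kV e a : uq_rel (ke e a * ke (~~ e) a)%nc (EConst 1)
| uq_kk a b : uq_rel (ke true a * ke true b)%nc (ke true b * ke true a)%nc
| uq_kx e a i :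
    uq_rel (ke true a * xe e i * ke false a)%nc
           ((q ^ (sg e * form (eps a) (alpha i))) *: xe e i)%nc
| uq_xx_eq i :
    uq_rel (sbr 1 (hx true i) (hx false i)).1
           ((qa (lo i) - (qa (lo i))^-1)^-1 *:
             (ke true (lo i) * ke false (hi i)
              - ke false (lo i) * ke true (hi i)))%nc
| uq_xx_neq i j : i != j ->
    uq_rel (sbr 1 (hx true i) (hx false j)).1 (EConst 0)
| uq_xx0 e i j : form (alpha i) (alpha j) = 0 ->
    uq_rel (sbr 1 (hx e i) (hx e j)).1 (EConst 0)
| uq_serre e i l :
    form (alpha i) (alpha i) != 0 -> (l == i.+1 :> nat) || (i == l.+1 :> nat) ->
    uq_rel (sbr (qa (lo i))^-1 (hx e i) (sbr (qa (lo i)) (hx e i) (hx e l))).1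
           (EConst 0)
| uq_serre4 e j i l :
    form (alpha i) (alpha i) = 0 -> i = j.+1 :> nat -> l = i.+1 :> nat ->
    uq_rel (sbr 1 (sbr (qa (hi i)) (sbr (qa (lo i)) (hx e j) (hx e i)) (hx e l))
                  (hx e i)).1
           (EConst 0).

Definition Uq := presented uq_rel.

HB.instance Definition _ := GRing.PzRing.on Uq.
HB.instance Definition _ := GRing.Lmodule.on Uq.

Lemma Uq_neq0 : (1 : Uq) != 0.
Proof.
apply: (@presented_neq0 _ _ uq_rel (fun g => if g is GX _ _ then 0 else 1)).
by move=> x y; case=> /= *; rewrite ?(mulr0, mul0r, mulr1, subrr, mulrN1, addr0).
Qed.

HB.instance Definition _ := GRing.PzSemiRing_isNonZero.Build Uq Uq_neq0.
HB.instance Definition _ :=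
  GRing.Lmodule_isLalgebra.Build K Uq (@presented_scaleAl _ _ uq_rel).
HB.instance Definition _ :=
  GRing.Lalgebra_isAlgebra.Build K Uq (@presented_scaleAr _ _ uq_rel).

(* The class in Uq of an expression. *)
Definition Upi (x : uexpr) : Uq := ppi uq_rel x.

Definition highest_weight (V : lmodType Uq) (lam : 'I_N -> K) (zeta : V) : Prop :=
  [/\ zeta != 0,
      forall v, exists u, v = u *: zeta,
      forall i, Upi (xe true i) *: zeta = 0
    & forall a, Upi (ke true a) *: zeta = (lam a)%:A *: zeta].

End Data.

Section OddReflection.
Variables (N : nat) (s' : N.-tuple bool) (i : 'I_N.-1).

Local Notation dp := (dsg s' (lo i)).
Local Notation dq := (dsg s' (hi i)).

(* The odd reflection from s to s' = swap s i on generators; s enters only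
   through s'. *)
Definition beta (g : qgen N) : expr K (qgen N) :=
  match g with
  | GK e a =>
      if a == lo i then (dp%:~R *: ke e (hi i))%nc
      else if a == hi i then (dq%:~R *: ke e (lo i))%nc
      else ke e a
  | GX true j =>
      if j == i then ((- dq)%:~R *: (xe false i * ke true (lo i) * ke false (hi i)))%nc
      else if j.+1 == i :> nat then
        ((dp%:~R * q ^ (- dp)) *: (sbr (q ^ dp) (hx s' true j) (hx s' true i)).1)%nc
      else if j == i.+1 :> nat then
        ((- dq)%:~R *: (sbr (q ^ (- dq)) (hx s' true i) (hx s' true j)).1)%nc
      else xe true j
  | GX false j =>
      if j == i then ((- dp)%:~R *: (ke true (hi i) * ke false (lo i) * xe true i))%nc
      else if j.+1 == i :> nat then
        (q ^ dp *: (sbr (q ^ (- dp)) (hx s' false i) (hx s' false j)).1)%nc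
      else if j == i.+1 :> nat then
        ((-1) *: (sbr (q ^ dq) (hx s' false j) (hx s' false i)).1)%nc
      else xe false j
  end.

End OddReflection.

(* The sign automorphism of Uq attached to chi, with chi a = 1 or -1; it
   exchanges the highest weights lam and (chi a * lam a)_a. *)
Definition sign_twist N (chi : 'I_N -> int) (g : qgen N) : expr K (qgen N) :=
  match g with
  | GK e a => ((chi a)%:~R *: ke e a)%nc
  | GX true j => ((chi (lo j) * chi (hi j))%:~R *: xe true j)%nc
  | GX false j => xe false j
  end.

(* The signs that beta puts on k_i and k_(i+1). *)
Definition beta_sign N (s' : N.-tuple bool) (i : 'I_N.-1) (a : 'I_N) : int :=
  if a == lo i then dsg s' (hi i)
  else if a == hi i then dsg s' (lo i) else 1.

(* beta carries signs on k_i and k_(i+1), whereas the weights q_j^(Lambda_j) are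
   normalised up to sign twists. Composing with the twist by these signs gives
   k_i |-> k_(i+1) and k_(i+1) |-> k_i. *)
Definition normalised_beta N (s' : N.-tuple bool) (i : 'I_N.-1) (g : qgen N) :
    expr K (qgen N) :=
  esubst (sign_twist (beta_sign s' i)) (beta s' i g).

(* V is isomorphic to the pullback of W along b, a map that sends each generator
   of Uq s to an expression over Uq s'. *)
Definition iso_along N (s s' : N.-tuple bool) (b : qgen N -> expr K (qgen N))
    (V : lmodType (Uq s)) (W : lmodType (Uq s')) : Prop :=
  exists f : {additive V -> W}, bijective f /\
    forall (x : expr K (qgen N)) v, f (Upi s x *: v) = Upi s' (esubst b x) *: f v.

End QuantumSuperalgebra.

Definition simple_module (A : pzRingType) (V : lmodType A) : Prop :=
  (exists v : V, v != 0) /\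
  forall S : {pred V}, GRing.submod_closed S ->
    (forall v, v \in S -> v = 0) \/ (forall v, v \in S).

(* S(m|n), with false for 0 and true for 1. *)
Definition parity_seq (m n : nat) (s : (m + n).-tuple bool) : Prop :=
  count_mem false s = m /\ count_mem true s = n.

Section ComplexPowers.
Variable R : realType.
Local Notation C := R[i].

Definition cexp (z : C) : C :=
  (expR (complex.Re z) * cos (complex.Im z)
   +i* (expR (complex.Re z) * sin (complex.Im z)))%C.

(* q^z for the branch logq of log q *)
Definition qpow (logq z : C) : C := cexp (z * logq).

(* q_a^z, where q_a = q^(d_a) *)
Definition qapow (logq : C) N (s : N.-tuple bool) (a : 'I_N) (z : C) : C :=
  qpow logq ((dsg s a)%:~R * z).

Definition weight (logq : C) N (s : N.-tuple bool) (Lam : 'I_N -> C) (a : 'I_N) : C :=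
  qapow logq s a (Lam a).

(* Normalisation of the exponents x, y of the weight at positions i, i + 1 with
   d_i = - d_(i+1): the only vanishing of q^(x+y) - q^-(x+y) is x + y = 0. Up to
   a sign twist, and up to the periods of z |-> q^z, every weight satisfies this:
   take -pi/2 < Im (d_j * Lambda_j * logq) <= pi/2 for all j. *)
Definition normalised_pair (logq x y : C) : Prop :=
  qpow logq (2 * (x + y)) = 1 -> x + y = 0.

(* Lambda^[i]; all q_j are those of s, not of swap s i. *)
Definition reflected_weight (logq : C) N (s : N.-tuple bool) (i : 'I_N.-1)
    (Lam : 'I_N -> C) (a : 'I_N) : C :=
  if a == lo i then qapow logq s (hi i) (Lam (hi i) + 1)
  else if a == hi i then qapow logq s (lo i) (Lam (lo i) - 1)
  else qapow logq s a (Lam a).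

End ComplexPowers.

(* Main.v *)
From HB Require Import structures.
Require Import Defs.
From mathcomp Require Import all_boot all_order all_algebra.
From mathcomp Require Import perm boolp reals sequences exp trigo ring.
From mathcomp.real_closed Require Import complex.

Set Implicit Arguments.
Unset Strict Implicit.
Unset Printing Implicit Defensive.

Import Order.TTheory GRing.Theory Num.Theory.
Local Open Scope ring_scope.

(* A simple highest weight module is determined by its highest weight using only
   the torus relations and [x_i^+, x_j^-] = delta_ij h_i: every expression sends
   the maximal vector to a combination of words in the x_j^- that depends only on
   the weight, and the coefficient of the empty word can be read off by a torus
   element that scales words according to their length. The Serre relations play
   no role. It is therefore enough to check those few relations for the images of
   the generators under the odd reflection, together with the surjectivity of the
   reflection, and to see that x_i^- zeta is a maximal vector of the right weight
   for the reflected generators. It is nonzero because x_i^+ x_i^- zeta is a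
   multiple of [Lambda_i + Lambda_(i+1)]_q zeta. *)

(** * Uniqueness of simple highest weight modules *)

(** V and W are modules over different algebras, so the common language is that of free expressions,
    evaluated by [aev] on a family [g : qgen N -> A] in an arbitrary algebra: the standard
    generators of [Uq q s] for V, the reflected generators inside [Uq q (swap s i)] for W. The
    isomorphism sends [aev g x *: zeta] to [aev h x *: eta]; it is well defined and injective once
    both vectors are annihilated by the same expressions.

    The reflection is used from the side of W: [eta] is x_i^- applied to the maximal vector of W,
    where x_i^- is a generator for the swapped sequence, and the shifts by 1 and -1 in the reflected
    weight are exactly what this x_i^- undoes. Surjectivity turns the simplicity of W over its own
    algebra into a property of the reflected family, since every element acting on W is then the
    value of an expression. *)

Fixpoint aev (K : fieldType) (A : algType K) (G : Type) (g : G -> A)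
    (x : expr K G) : A :=
  match x with
  | EGen a => g a
  | EConst c => c%:A
  | EAdd x y => aev g x + aev g y
  | EMul x y => aev g x * aev g y
  end.

Lemma Upi_esubst (K : fieldType) (q : K) N (s : N.-tuple bool)
    (G : Type) (b : G -> expr K (qgen N)) x :
  Upi q s (esubst b x) = aev (fun a => Upi q s (b a)) x.
Proof.
elim: x => //= [c | x <- y <- | x <- y <-].
- exact: ppiC.
- exact: ppiD.
- exact: ppiM.
Qed.

Lemma UpiE (K : fieldType) (q : K) N (s : N.-tuple bool) x :
  Upi q s x = aev (fun a => Upi q s (EGen a)) x.
Proof.
rewrite -Upi_esubst; congr (Upi _ _ _).
by elim: x => //= x {1}-> y {1}->.
Qed.

Section Cartan.
Variables (K : fieldType) (q : K) (N : nat) (s : N.-tuple bool).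
Implicit Types (i j : 'I_N.-1) (a b : 'I_N) (e : bool).

(* [(eps_a | alpha_j)] *)
Definition wt a j : int := dsg s a * ((a == lo j)%:Z - (a == hi j)%:Z).

Definition par j : bool := tnth s (lo j) (+) tnth s (hi j).

Definition ssign (b c : bool) : K := (-1) ^+ (b && c).

Definition cartan_expr j : expr K (qgen N) :=
  ((qa q s (lo j) - (qa q s (lo j))^-1)^-1 *:
     (ke K true (lo j) * ke K false (hi j)
      - ke K false (lo j) * ke K true (hi j)))%nc.

(** The rules are oriented so that torus elements and the x_i^+ move to the right, towards the
    maximal vector. The family is arbitrary so that the record covers both the generators of a [Uq]
    and their reflected images. *)
Record cartan (A : algType K) (g : qgen N -> A) : Prop := Cartan {
  cartan_kV : forall e a, g (GK e a) * g (GK (~~ e) a) = 1;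
  cartan_kk : forall e e' a b,
    g (GK e a) * g (GK e' b) = g (GK e' b) * g (GK e a);
  cartan_kx : forall e a e' j, g (GK e a) * g (GX e' j) =
    q ^ (sg e * sg e' * wt a j) *: (g (GX e' j) * g (GK e a));
  cartan_xx : forall i j, g (GX true i) * g (GX false j) =
    ssign (par i) (par j) *: (g (GX false j) * g (GX true i)) +
    (if i == j then aev g (cartan_expr i) else 0) }.

Record hwvec (A : algType K) (g : qgen N -> A) (V : lmodType A)
    (lam : 'I_N -> K) (zeta : V) : Prop := Hwvec {
  hw_neq0 : zeta != 0;
  hw_x : forall j, g (GX true j) *: zeta = 0;
  hw_k : forall a, g (GK true a) *: zeta = (lam a)%:A *: zeta }.

(** [V] is only a module over [A], so a scalar of [K] acts through [c%:A]; this lemma and the next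
    ones supply K-linearity. *)
Lemma algZ (A : algType K) (V : lmodType A) (c : K) (u : A) (v : V) :
  (c *: u) *: v = c%:A *: (u *: v).
Proof. by rewrite scalerA mulr_algl. Qed.

Lemma algZZ (A : algType K) (V : lmodType A) (c d : K) (v : V) :
  c%:A *: (d%:A *: v) = (c * d)%:A *: v.
Proof. by rewrite !scalerA mulr_algl scalerA. Qed.

Lemma algC (A : algType K) (V : lmodType A) (c : K) (u : A) (v : V) :
  u *: (c%:A *: v) = c%:A *: (u *: v).
Proof. by rewrite !scalerA mulr_algl mulr_algr. Qed.

Lemma alg_eq0 (A : algType K) (V : lmodType A) (c : K) (v : V) :
  c != 0 -> c%:A *: v = 0 -> v = 0.
Proof.
move=> c0 h; have := congr1 (fun w => (c^-1)%:A *: w) h.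
by rewrite algZZ mulVf // !scale1r scaler0.
Qed.

Lemma hw_lam_neq0 (A : algType K) (g : qgen N -> A) (V : lmodType A)
    (lam : 'I_N -> K) (zeta : V) a :
  cartan g -> hwvec g lam zeta -> lam a != 0.
Proof.
move=> cg hz; apply/eqP => l0; have := hw_neq0 hz; apply/negP; rewrite negbK.
have := congr1 (fun v => g (GK false a) *: v) (hw_k hz a).
by rewrite scalerA (cartan_kV cg false) l0 !scale0r scaler0 scale1r => ->.
Qed.

Lemma hw_kV (A : algType K) (g : qgen N -> A) (V : lmodType A)
    (lam : 'I_N -> K) (zeta : V) e a :
  cartan g -> hwvec g lam zeta ->
  g (GK e a) *: zeta = (lam a ^ sg e)%:A *: zeta.
Proof.
move=> cg hz; case: e; first by rewrite (hw_k hz).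
have l0 := hw_lam_neq0 a cg hz.
have := congr1 (fun v => g (GK false a) *: v) (hw_k hz a).
rewrite scalerA (cartan_kV cg false) scale1r algC => {2}->.
by rewrite algZZ mulVf // !scale1r.
Qed.

(* A linear combination of words in the [x_j^-]. *)
Definition down := seq (K * seq 'I_N.-1).

Fixpoint dnw (A : algType K) (g : qgen N -> A) (w : seq 'I_N.-1) : A :=
  if w is j :: w' then g (GX false j) * dnw g w' else 1.

Definition dn (A : algType K) (g : qgen N -> A) (t : down) : A :=
  \sum_(p <- t) p.1 *: dnw g p.2.

Definition cst (t : down) : K := \sum_(p <- t | p.2 == [::]) p.1.

(** * Reduction of expressions to words in the lowering generators *)

Section Triangular.
Variable lam : 'I_N -> K.

(** Quantifying over all algebras, families and modules lets a single [t'] serve both modules under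
    comparison: they share only [q], [s] and [lam]. *)
Definition reduces (x : expr K (qgen N)) (t t' : down) : Prop :=
  forall (A : algType K) (g : qgen N -> A) (V : lmodType A) (zeta : V),
    cartan g -> hwvec g lam zeta ->
    aev g x *: (dn g t *: zeta) = dn g t' *: zeta.

Lemma dn_nil (A : algType K) (g : qgen N -> A) : dn g [::] = 0.
Proof. by rewrite /dn big_nil. Qed.

Lemma dn_cons (A : algType K) (g : qgen N -> A) c w t :
  dn g ((c, w) :: t) = c *: dnw g w + dn g t.
Proof. by rewrite /dn big_cons. Qed.

Lemma dn_cat (A : algType K) (g : qgen N -> A) t t' :
  dn g (t ++ t') = dn g t + dn g t'.
Proof. by rewrite /dn big_cat. Qed.

Lemma dn_scale (A : algType K) (g : qgen N -> A) c t :
  dn g [seq (c * p.1, p.2) | p <- t] = c *: dn g t.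
Proof.
rewrite /dn big_map scaler_sumr; apply: eq_bigr => p _.
by rewrite scalerA.
Qed.

Lemma dn_prefix (A : algType K) (g : qgen N -> A) j t :
  dn g [seq (p.1, j :: p.2) | p <- t] = g (GX false j) * dn g t.
Proof.
rewrite /dn big_map mulr_sumr; apply: eq_bigr => p _.
by rewrite scalerAr.
Qed.

Lemma dn1 (A : algType K) (g : qgen N -> A) w : dn g [:: (1, w)] = dnw g w.
Proof. by rewrite dn_cons dn_nil addr0 scale1r. Qed.

Lemma reduces_words x :
  (forall w, exists t', reduces x [:: (1, w)] t') ->
  forall t, exists t', reduces x t t'.
Proof.
move=> xw; elim=> [|[c w] t [t' IH]].
  by exists [::] => A g V zeta _ _; rewrite dn_nil !scale0r scaler0.
have [t1 t1P] := xw w.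
exists ([seq (c * p.1, p.2) | p <- t1] ++ t') => A g V zeta cg hz.
rewrite dn_cons dn_cat dn_scale !scalerDl scalerDr IH // (algZ c (dnw g w)).
by rewrite (algZ c (dn g t1)) algC -dn1 t1P.
Qed.

Lemma reducesD x y t tx ty :
  reduces x t tx -> reduces y t ty -> reduces (x + y)%nc t (tx ++ ty).
Proof.
by move=> xt yt A g V zeta cg hz; rewrite /= scalerDl xt // yt // dn_cat scalerDl.
Qed.

Lemma reducesM x y t t1 t2 :
  reduces y t t1 -> reduces x t1 t2 -> reduces (x * y)%nc t t2.
Proof. by move=> yt xt A g V zeta cg hz; rewrite /= -scalerA yt ?xt. Qed.

Lemma reducesC c t : reduces (EConst c) t [seq (c * p.1, p.2) | p <- t].
Proof. by move=> A g V zeta cg hz; rewrite /= dn_scale [RHS]algZ. Qed.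

Lemma reduces_k e a t : exists t', reduces (ke K e a) t t'.
Proof.
apply: reduces_words => w {t}; elim: w => [|j w [t IH]].
  exists [:: (lam a ^ sg e, [::])] => A g V zeta cg hz.
  by rewrite /= dn1 dn_cons dn_nil addr0 scale1r (hw_kV _ _ cg hz).
exists [seq (q ^ (sg e * sg false * wt a j) * p.1, p.2)
       | p <- [seq (p.1, j :: p.2) | p <- t]] => A g V zeta cg hz.
rewrite dn_scale dn_prefix dn1 [LHS]/= scalerA mulrA (cartan_kx cg).
rewrite -scalerAl -mulrA (algZ _ (_ * _)) (algZ _ (_ * dn g t)) -!(scalerA (g _)).
by have := IH _ _ _ _ cg hz; rewrite dn1 /= -!scalerA => ->.
Qed.

Lemma reduces_cartan j t : exists t', reduces (cartan_expr j) t t'.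
Proof.
have [t1 r1] := reduces_k false (hi j) t.
have [t2 r2] := reduces_k true (lo j) t1.
have [t3 r3] := reduces_k true (hi j) t.
have [t4 r4] := reduces_k false (lo j) t3.
eexists; apply: reducesM (reducesC _ _).
apply: reducesD (reducesM r1 r2) _.
exact: reducesM (reducesM r3 r4) (reducesC _ _).
Qed.

(** Induction on the word: x_j^+ passes the first letter up to a sign, and the Cartan term left
    behind acts on the shorter word, where [reduces_cartan] applies. *)
Lemma reduces_x j t : exists t', reduces (xe K true j) t t'.
Proof.
apply: reduces_words => w {t}; elim: w => [|j' w [t IH]].
  exists [::] => A g V zeta cg hz.
  by rewrite /= dn1 dn_nil scale0r scale1r (hw_x hz).
have [t' t'P] := reduces_cartan j [:: (1, w)].
exists ([seq (ssign (par j) (par j') * p.1, p.2)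
       | p <- [seq (p.1, j' :: p.2) | p <- t]] ++
       if j == j' then t' else [::]) => A g V zeta cg hz.
rewrite dn_cat dn_scale dn_prefix dn1 [LHS]/= scalerA mulrA (cartan_xx cg).
rewrite mulrDl !scalerDl; congr (_ + _).
  rewrite -scalerAl -mulrA (algZ _ (_ * _)) (algZ _ (_ * dn g t)) -!(scalerA (g _)).
  by have := IH _ _ _ _ cg hz; rewrite dn1 /= => ->.
case: eqP => _; last by rewrite mul0r dn_nil.
by have := t'P _ _ _ _ cg hz; rewrite dn1 -scalerA.
Qed.

Lemma triangular x t : exists t', reduces x t t'.
Proof.
elim: x t => [[[] j|e a]|c|x IHx y IHy|x IHx y IHy] t.
- exact: reduces_x.
- exists [seq (p.1, j :: p.2) | p <- t] => A g V zeta cg hz.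
  by rewrite dn_prefix scalerA.
- exact: reduces_k.
- by eexists; apply: reducesC.
- have [t1 r1] := IHx t; have [t2 r2] := IHy t.
  by eexists; apply: reducesD r1 r2.
- have [t1 r1] := IHy t; have [t2 r2] := IHx t1.
  by eexists; apply: reducesM r1 r2.
Qed.

End Triangular.
End Cartan.

(** * Separation of words by length and comparison of modules *)

Section Uniqueness.
Variables (K : fieldType) (q : K) (N : nat) (s : N.-tuple bool).
Hypotheses (q_neq0 : q != 0)
  (q_not_root : forall k : nat, (0 < k)%N -> q ^+ k != 1).
Implicit Types (i j : 'I_N.-1) (a b : 'I_N) (e : bool).
Lemma lo_neq_hi j : (lo j == hi j) = false.
Proof. by rewrite -val_eqE /= ltn_eqF. Qed.

Lemma dsg_sqr a : dsg s a * dsg s a = 1.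
Proof. by rewrite /dsg; case: (tnth _ _). Qed.

Section Separation.
Variables (A : algType K) (g : qgen N -> A) (V : lmodType A)
  (lam : 'I_N -> K) (zeta : V).
Hypotheses (cg : cartan q s g) (hz : hwvec g lam zeta).

(* All [x_j^-] have the same weight under this element, so its eigenvalue on a
   word applied to [zeta] is determined by the length of the word. *)
Definition rho : A := \prod_a g (GK (~~ tnth s a) a) ^+ (N - a).

Lemma rho_x j : rho * g (GX false j) = q^-1 *: (g (GX false j) * rho).
Proof.
(* Only the positions j and j + 1 contribute, by q^-(N-j) and q^(N-j-1). *)
have -> : q^-1 = \prod_a (q ^ ((a == hi j)%:Z - (a == lo j)%:Z)) ^+ (N - a).
  rewrite (bigD1 (lo j)) // (bigD1 (hi j)) /=; last by rewrite eq_sym lo_neq_hi.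
  rewrite big1 => [|a /andP[/negbTE al /negbTE ah]]; last by rewrite al ah expr1n.
  rewrite !eqxx lo_neq_hi eq_sym lo_neq_hi mulr1 sub0r subr0 exprN1 expr1z /=.
  rewrite -(subnSK (ltn_trans (ltnSn j) (ltn_ord (hi j)))) exprS -mulrA -exprMn.
  by rewrite mulVf // expr1n mulr1.
apply: (big_ind2 (fun u c => u * g (GX false j) = c *: (g (GX false j) * u))).
- by rewrite mul1r mulr1 scale1r.
- move=> u c v d uE vE; rewrite -mulrA vE -scalerAr (mulrA u) uE -scalerAl scalerA.
  by rewrite mulrC mulrA.
move=> a _; have ux : g (GK (~~ tnth s a) a) * g (GX false j) =
    q ^ ((a == hi j)%:Z - (a == lo j)%:Z) *: (g (GX false j) * g (GK (~~ tnth s a) a)).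
  rewrite (cartan_kx cg); congr (q ^ _ *: _).
  by rewrite /wt /dsg /sg; case: (tnth _ _); do 2!case: eqP.
move: (g (GK _ a)) (q ^ _) ux => u c ux.
elim: (N - a)%N => [|n IH]; first by rewrite !expr0 mul1r mulr1 scale1r.
rewrite [u ^+ n.+1]exprSr [c ^+ n.+1]exprS -mulrA ux -scalerAr (mulrA (u ^+ n)) IH.
by rewrite -scalerAl scalerA -mulrA.
Qed.

Lemma rho_zeta : exists2 mu, mu != 0 & rho *: zeta = mu%:A *: zeta.
Proof.
rewrite /rho; elim/big_ind: _.
- by exists 1; rewrite ?oner_neq0 // !scale1r.
- move=> u v [c c0 uc] [d d0 vd]; exists (d * c); rewrite ?mulf_neq0 //.
  by rewrite -scalerA vd algC uc algZZ.
move=> a _; elim: (N - a)%N => [|n [c c0 IH]].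
  by exists 1; rewrite ?oner_neq0 // !scale1r.
exists (c * lam a ^ sg (~~ tnth s a)).
  by rewrite mulf_neq0 ?expfz_neq0 // (hw_lam_neq0 _ cg hz).
by rewrite exprS -scalerA IH algC (hw_kV _ _ cg hz) algZZ.
Qed.

Lemma rho_word mu w : rho *: zeta = mu%:A *: zeta ->
  rho *: (dnw g w *: zeta) = (mu / q ^+ size w)%:A *: (dnw g w *: zeta).
Proof.
move=> rz; elim: w => [|j w IH]; first by rewrite /= expr0 divr1 scale1r.
rewrite /= -(scalerA (g _)) scalerA rho_x algZ -scalerA IH algC algZZ.
by rewrite mulrCA -invfM -exprS.

Qed.

(** [P] is the product of the [rho - mu / q ^+ k.+1] for [k < n]. It kills words of length 1 to n
    applied to the maximal vector; the factor for the empty word is left out. *)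
Lemma rho_proj mu n : exists P : A, forall c (v : V), rho *: v = c%:A *: v ->
  P *: v = (\prod_(k < n) (c - mu / q ^+ k.+1))%:A *: v.
Proof.
elim: n => [|n [P PE]]; first by exists 1 => c v _; rewrite big_ord0 !scale1r.
exists (P * (rho - (mu / q ^+ n.+1)%:A)) => c v rv.
rewrite -scalerA scalerBl rv -scalerBl -scalerBl algC (PE _ _ rv) algZZ.
by rewrite big_ord_recr /= mulrC.
Qed.

Lemma dn_scale_zeta t :
  dn g t *: zeta = \sum_(p <- t) p.1%:A *: (dnw g p.2 *: zeta).
Proof.
rewrite /dn scaler_suml; apply: eq_bigr => p _.
by rewrite [LHS]algZ.
Qed.

Lemma separation t : exists (P : A) (c : K), c != 0 /\
  P *: (dn g t *: zeta) = (c * cst t)%:A *: zeta.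
Proof.
have [mu mu0 rz] := rho_zeta.
have [n nP] : exists n, all (fun p => size p.2 <= n)%N t.
  elim: t => [|p t [n IH]]; first by exists 0%N.
  exists (maxn (size p.2) n); rewrite /= leq_maxl; apply: sub_all IH => p' h.
  by rewrite leq_max h orbT.
have [P PE] := rho_proj mu n.
exists P, (\prod_(k < n) (mu - mu / q ^+ k.+1)); split.
  (* A zero factor would give [q ^+ k.+1 = 1]. *)
  apply/prodf_neq0 => k _; rewrite subr_eq0 -[X in X == _]mulr1.
  rewrite (inj_eq (mulfI mu0)) eq_sym invr_eq1; exact: q_not_root.
rewrite dn_scale_zeta scaler_sumr /cst mulr_sumr !scaler_suml [RHS]big_mkcond /=.
apply: eq_big_seq => -[c w] /(allP nP) /= wn.
rewrite algC (PE _ _ (rho_word w rz)) algZZ.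
case: w wn => [|j w] wn /=.
  by rewrite expr0 divr1 scale1r mulrC.
by rewrite (bigD1 (Ordinal wn)) //= subrr mul0r mulr0 !scale0r.
Qed.

Lemma cst_uniq t c : dn g t *: zeta = c%:A *: zeta -> cst t = c.
Proof.
(* Subtracting c times the empty word gives a combination that kills [zeta], so its constant
   coefficient [cst t - c] has to vanish. *)
move=> tc; have [P [d [d0]]] := separation ((- c, [::]) :: t).
rewrite dn_cons scalerDl tc /= scaleNr scaleNr addNr scaler0 => /esym /eqP; apply: contraTeq => ct.
apply/eqP => h; have := hw_neq0 hz; apply/negP; rewrite negbK; apply/eqP.
apply: (alg_eq0 _ h); rewrite mulf_neq0 // /cst big_cons /= addrC subr_eq0.
exact: ct.
Qed.

End Separation.

(** Simplicity in terms of expressions, so that it makes sense for a family [g]: [zeta] generates,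
    and every nonzero vector leads back to [zeta]. *)
Definition hw_simple (A : algType K) (g : qgen N -> A) (V : lmodType A)
    (zeta : V) : Prop :=
  (forall v, exists x, v = aev g x *: zeta) /\
  forall v, v != 0 -> exists x, aev g x *: v = zeta.

Section Comparison.
Variables (A B : algType K) (g : qgen N -> A) (h : qgen N -> B)
  (V : lmodType A) (W : lmodType B) (lam : 'I_N -> K) (zeta : V) (eta : W).
Hypotheses (cg : cartan q s g) (hzeta : hwvec g lam zeta)
  (ch : cartan q s h) (heta : hwvec h lam eta).

(* Both sides are described by the same combination of words, and its constant
   coefficient is read off on either side. *)
Lemma annihilator_sub x : hw_simple h eta ->
  aev g x *: zeta = 0 -> aev h x *: eta = 0.
Proof.
move=> [_ simpleW] xz; apply/eqP; apply/contraT => /simpleW[y yE].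
have [t tP] := triangular q s lam (y * x)%nc [:: (1, [::])].
have tg := tP _ _ _ _ cg hzeta; have th := tP _ _ _ _ ch heta.
rewrite dn1 /= scale1r -scalerA xz scaler0 in tg.
rewrite dn1 /= scale1r -scalerA yE in th.
have /eqP := oner_neq0 K; case; rewrite -(cst_uniq ch heta (t := t) (c := 1)).
  by apply: (cst_uniq cg hzeta); rewrite -tg !scale0r.
by rewrite -th !scale1r.
Qed.

End Comparison.

Lemma hw_iso (A B : algType K) (g : qgen N -> A) (h : qgen N -> B)
    (V : lmodType A) (W : lmodType B) (lam : 'I_N -> K) (zeta : V) (eta : W) :
  cartan q s g -> hwvec g lam zeta -> hw_simple g zeta ->
  cartan q s h -> hwvec h lam eta -> hw_simple h eta ->
  exists f : {additive V -> W}, bijective f /\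
    forall x v, f (aev g x *: v) = aev h x *: f v.
Proof.
move=> cg hzeta simV ch heta simW.
have gh x : aev g x *: zeta = 0 -> aev h x *: eta = 0.
  exact: (annihilator_sub cg hzeta ch heta).
have hg x : aev h x *: eta = 0 -> aev g x *: zeta = 0.
  exact: (annihilator_sub ch heta cg hzeta).
pose sub x y : expr K (qgen N) := (x - y)%nc.
have subE (C : algType K) (k : qgen N -> C) x y :
    aev k (sub x y) = aev k x - aev k y.
  by rewrite /= mulr_algl scaleN1r.
have eqgh x y : aev g x *: zeta = aev g y *: zeta ->
    aev h x *: eta = aev h y *: eta.
  move=> e; apply/eqP; rewrite -subr_eq0 -scalerBl -subE; apply/eqP/gh.
  by rewrite subE scalerBl e subrr.
have eqhg x y : aev h x *: eta = aev h y *: eta ->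
    aev g x *: zeta = aev g y *: zeta.
  move=> e; apply/eqP; rewrite -subr_eq0 -scalerBl -subE; apply/eqP/hg.
  by rewrite subE scalerBl e subrr.
(* [X] and [Y] choose an expression for each vector; by [eqgh] and [eqhg] the choice does not affect
   the image. *)
have [X XE] := choice simV.1; have [Y YE] := choice simW.1.
pose f v := aev h (X v) *: eta.
have fE x : f (aev g x *: zeta) = aev h x *: eta by apply: eqgh; rewrite -XE.
have fB : zmod_morphism f.
  by move=> u v; rewrite {1}(XE u) {1}(XE v) -scalerBl -subE fE subE scalerBl.
pose fM := GRing.isZmodMorphism.Build _ _ f fB.
pose fA : {additive V -> W} := HB.pack f fM.
exists fA; split.
  exists (fun w => aev g (Y w) *: zeta) => [v|w].
    by rewrite [RHS]XE; apply: eqhg; rewrite -YE.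
  by rewrite [LHS]fE -YE.
move=> x v; rewrite {1}(XE v) scalerA.
by rewrite -[_ * _]/(aev g (x * X v)%nc) [LHS]fE /= -scalerA.
Qed.
End Uniqueness.

(** * Linear combinations and brackets in an algebra *)

Section LinearReflection.
Variables (K : fieldType) (V : lmodType K).

Inductive lexp := LVar of nat | LZero | LAdd of lexp & lexp | LOpp of lexp
  | LScale of K & lexp.

Fixpoint leval (env : seq V) e : V :=
  match e with
  | LVar n => nth 0 env n
  | LZero => 0
  | LAdd e1 e2 => leval env e1 + leval env e2
  | LOpp e => - leval env e
  | LScale c e => c *: leval env e
  end.

Fixpoint lcoef e (n : nat) : K :=
  match e with
  | LVar m => if eqn m n then 1 else 0
  | LZero => 0
  | LAdd e1 e2 => lcoef e1 n + lcoef e2 n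
  | LOpp e => - lcoef e n
  | LScale c e => c * lcoef e n
  end.

Fixpoint lcoef_eq e1 e2 (n : nat) : Prop :=
  if n is m.+1 then lcoef e1 m = lcoef e2 m /\ lcoef_eq e1 e2 m else True.

Lemma leval_coef env e :
  leval env e = \sum_(i < size env) lcoef e i *: nth 0 env i.
Proof.
elim: e => [m||e1 IH1 e2 IH2|e IH|c e IH] /=.
- case: (ltnP m (size env)) => mn.
    rewrite (bigD1 (Ordinal mn)) //= -[eqn _ _]/(m == m) eqxx scale1r.
    rewrite big1 ?addr0 // => j /negbTE jm; rewrite -[eqn _ _]/(m == j).
    by rewrite eq_sym [_ == _]jm scale0r.
  rewrite nth_default // big1 // => j _; rewrite -[eqn _ _]/(m == j).
  by rewrite gtn_eqF ?scale0r // (leq_trans (ltn_ord j)).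
- by rewrite big1 // => i _; rewrite scale0r.
- by rewrite IH1 IH2 -big_split; apply: eq_bigr => i _; rewrite scalerDl.
- by rewrite IH -sumrN; apply: eq_bigr => i _; rewrite scaleNr.
- by rewrite IH scaler_sumr; apply: eq_bigr => i _; rewrite scalerA.
Qed.

Lemma leval_eq env e1 e2 :
  lcoef_eq e1 e2 (size env) -> leval env e1 = leval env e2.
Proof.
rewrite !leval_coef; move: (nth 0 env) (size env) => m n.
elim: n => [|n IH] /= h; first by rewrite !big_ord0.
by rewrite !big_ord_recr /= h.1 (IH h.2).
Qed.

End LinearReflection.

(* Atoms are compared up to conversion: the ring structure of an algebra is
   inferred along several paths. *)
Ltac lin_index env m :=
  lazymatch env with
  | ?x :: ?env' =>
      match constr:(tt) with
      | _ => let _ := match constr:(tt) with _ => unify x m end in constr:(0%N)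
      | _ => let n := lin_index env' m in constr:(S n)
      end
  end.

Ltac lin_atoms env e :=
  lazymatch e with
  | (?a + ?b)%R => let env' := lin_atoms env a in lin_atoms env' b
  | (- ?a)%R => lin_atoms env a
  | (_ *: ?a)%R => lin_atoms env a
  | 0%R => env
  | ?m => match constr:(tt) with
          | _ => let _ := lin_index env m in env
          | _ => constr:(m :: env)
          end
  end.

Ltac lin_reify K env e :=
  lazymatch e with
  | (?a + ?b)%R => let a' := lin_reify K env a in
                   let b' := lin_reify K env b in constr:(LAdd a' b')
  | (- ?a)%R => let a' := lin_reify K env a in constr:(LOpp a')
  | (?c *: ?a)%R => let a' := lin_reify K env a in constr:(LScale c a')
  | 0%R => constr:(LZero K)
  | ?m => let n := lin_index env m in constr:(LVar K n)
  end.

(* Reduces an equality of linear combinations of the same vectors to the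
   equalities of their coefficients. *)
Ltac lin_split K A :=
  lazymatch goal with
  | |- ?l = ?r =>
    let env := lin_atoms (@nil A) l in
    let env := lin_atoms env r in
    let l' := lin_reify K env l in
    let r' := lin_reify K env r in
    apply: (@leval_eq K A env l' r'); rewrite /=; do !split
  end.

Ltac expand :=
  rewrite ?(mulrDl, mulrDr, mulNr, mulrN);
  rewrite -?scalerAl -?scalerAr;
  rewrite ?(mulrDl, mulrDr, mulNr, mulrN);
  rewrite -?scalerAl -?scalerAr ?mulrA.

Section Brackets.
Variables (K : fieldType) (A : algType K).
Implicit Types (a b x y : A) (c t : K).

(** The superbracket with its parity sign absorbed into [t], which keeps parities out of the
    computations. *)
Definition br t x y : A := x * y - t *: (y * x).

(** A twisted Leibniz rule: [r1] and [r2] measure the failure of [a1] and [a2] to commute with [b]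
    up to a scalar. *)
Lemma br_mull t a1 a2 b c1 c2 r1 r2 :
  a1 * b = c1 *: (b * a1) + r1 -> a2 * b = c2 *: (b * a2) + r2 ->
  br t a1 a2 * b = (c1 * c2) *: (b * br t a1 a2)
    + (c2 *: (r1 * a2) - t *: (a2 * r1)) + (a1 * r2 - (t * c1) *: (r2 * a1)).
Proof.
move=> h1 h2; rewrite /br mulrBl -scalerAl -!mulrA h1 h2.
expand; rewrite h1 h2; expand.
by lin_split K A; ring.
Qed.

Lemma br_mulr t a b1 b2 c1 c2 r1 r2 :
  a * b1 = c1 *: (b1 * a) + r1 -> a * b2 = c2 *: (b2 * a) + r2 ->
  a * br t b1 b2 = (c1 * c2) *: (br t b1 b2 * a)
    + (r1 * b2 - (t * c2) *: (b2 * r1)) + (c1 *: (b1 * r2) - t *: (r2 * b1)).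
Proof.
move=> h1 h2; rewrite /br mulrBr -scalerAr !mulrA h1 h2.
expand; rewrite -!mulrA h1 h2; expand.
by lin_split K A; ring.
Qed.

Definition qc c a b : Prop := a * b = c *: (b * a).

Lemma qc_mull c1 c2 a1 a2 b : qc c1 a1 b -> qc c2 a2 b -> qc (c1 * c2) (a1 * a2) b.
Proof.
by rewrite /qc => h1 h2; rewrite -mulrA h2 -scalerAr (mulrA a1) h1 -scalerAl scalerA -mulrA mulrC.
Qed.

Lemma qc_mulr c1 c2 a b1 b2 : qc c1 a b1 -> qc c2 a b2 -> qc (c1 * c2) a (b1 * b2).
Proof.
by rewrite /qc => h1 h2; rewrite mulrA h1 -scalerAl -(mulrA b1 a) h2 -scalerAr scalerA mulrA.
Qed.

Lemma qc_scale t u c a b : qc c a b -> qc c (t *: a) (u *: b).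
Proof.
rewrite /qc => h; rewrite -!scalerAl -!scalerAr h !scalerA; congr (_ *: _); ring.
Qed.

Lemma qc_brl t c1 c2 a1 a2 b : qc c1 a1 b -> qc c2 a2 b -> qc (c1 * c2) (br t a1 a2) b.
Proof.
move=> h1 h2; rewrite /qc (br_mull _ (r1 := 0) (r2 := 0) (c1 := c1) (c2 := c2)) ?addr0 //.
by rewrite !(mulr0, mul0r, scaler0, subr0, addr0).
Qed.

Lemma qc_brr t c1 c2 a b1 b2 : qc c1 a b1 -> qc c2 a b2 -> qc (c1 * c2) a (br t b1 b2).
Proof.
move=> h1 h2; rewrite /qc (br_mulr _ (r1 := 0) (r2 := 0) (c1 := c1) (c2 := c2)) ?addr0 //.
by rewrite !(mulr0, mul0r, scaler0, subr0, addr0).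
Qed.

Lemma qc_sym c a b : c != 0 -> qc c a b -> qc c^-1 b a.
Proof. by rewrite /qc => c0 ->; rewrite scalerA mulVf // scale1r. Qed.

Lemma qc_V c a a' b : c != 0 -> a * a' = 1 -> a' * a = 1 -> qc c a b -> qc c^-1 a' b.
Proof.
rewrite /qc => c0 aa' a'a h.
rewrite -[X in a' * X]mulr1 -aa' (mulrA b) -[b * a](scalerK c0) -h.
by rewrite -!scalerAl -scalerAr -!mulrA (mulrA a' a) a'a mul1r.
Qed.

(** Since x^2 = 0, both products are multiples of x y x. *)
Lemma qc_sq0_brl t x y : x * x = 0 -> qc (- t) x (br t x y).
Proof.
rewrite /qc /br => xx; expand; rewrite -!mulrA xx (mulrA x x) xx.
by expand; rewrite !(mulr0, mul0r, scaler0, oppr0, addr0, add0r) scaleNr.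
Qed.

End Brackets.

(* Here [x], [xm], [k] stand for x_i^+, x_i^-, k_i k_(i+1)^-1 at an odd node [i],
   and [y] or [z] for x_(i-1)^+ or x_(i+1)^+, with [l] the Cartan element of that
   neighbour; kV and lV are the inverses of [k] and [l], [Q] is q^(d_i), and [ep]
   is the sign (-1)^|y| or (-1)^|z|. Up to scalars [E] and [F], or [G] and [H],
   are the images of the neighbouring generators under the odd reflection. *)
Section OddNode.
Variables (K : fieldType) (A : algType K) (Q ep : K).
Variables (x xm k kV : A).
Hypotheses (Q0 : Q != 0) (Q1 : Q * Q - 1 != 0) (ep2 : ep ^+ 2 = 1).
Local Notation c := (Q - Q^-1)^-1.
Hypothesis x_xm : x * xm = -1 *: (xm * x) + c *: (k - kV).

Ltac lin :=
  lin_split K A; first [by ring: ep2 | by field: ep2; rewrite Q0 Q1].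

Section Left.
Variables (y ym l lV : A).
Hypotheses (y_xm : qc ep y xm) (x_ym : qc ep x ym).
Hypotheses (k_y : qc Q^-1 k y) (kV_y : qc Q kV y).
Hypotheses (k_ym : qc Q k ym) (kV_ym : qc Q^-1 kV ym).
Hypotheses (l_x : qc Q^-1 l x) (lV_x : qc Q lV x) (l_xm : qc Q l xm).
Hypotheses (lkV : l * kV = kV * l).
Hypothesis y_ym : y * ym = ep *: (ym * y) + (ep * c) *: (l - lV).

Local Notation E := (br (ep * Q) y x).
Local Notation F := (br (ep * Q^-1) xm ym).

(** The parameter [ep * Q] is the one for which the [k] part of the bracket of [x] and [xm] cancels.
    What remains is [y] times an invertible element, from which [y] can be recovered. *)
Lemma left_xm : E * xm = - ep *: (xm * E) + kV * y.
Proof.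
rewrite (@br_mull _ _ _ y x xm ep (-1) 0 (c *: (k - kV))) ?addr0 //.
expand; rewrite k_y kV_y mul0r mulr0; expand.
lin.
Qed.

Lemma left_ym : E * ym = ym * E - Q *: (l * x).
Proof.
rewrite (@br_mull _ _ _ y x ym ep ep ((ep * c) *: (l - lV)) 0) ?addr0 //.
expand; rewrite l_x lV_x mul0r mulr0; expand.
lin.
Qed.

(** Moving [E] past the two factors of [F] leaves [kV * y] and [l * x]. Against [ym] and [xm] these
    give kV (l - lV) and l (k - kV) with equal coefficients, and the mixed term l kV cancels. *)
Lemma left_left : E * F = - ep *: (F * E) + (ep * c) *: (l * k - kV * lV).
Proof.
rewrite (@br_mulr _ _ _ E xm ym (- ep) 1 (kV * y) (- Q *: (l * x))); first last.
- by rewrite left_ym scale1r scaleNr.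
- exact: left_xm.
have h1 : xm * l = Q^-1 *: (l * xm) by rewrite l_xm scalerA mulVf // scale1r.
have h2 : ym * kV = Q *: (kV * ym) by rewrite kV_ym scalerA mulfV // scale1r.
expand; rewrite h1 h2; expand.
rewrite -(mulrA kV y ym) -(mulrA l x xm) x_xm y_ym; expand.
rewrite -lkV; expand; lin.
Qed.

Lemma left_x : x * F = - ep *: (F * x) + ym * k.
Proof.
rewrite (@br_mulr _ _ _ x xm ym (-1) ep (c *: (k - kV)) 0) ?addr0 //.
expand; rewrite k_ym kV_ym mul0r mulr0; expand.
lin.
Qed.

End Left.

Section Right.
Variables (z zm l lV : A).
Hypotheses (z_xm : qc ep z xm) (x_zm : qc ep x zm).
Hypotheses (k_z : qc Q k z) (kV_z : qc Q^-1 kV z).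
Hypotheses (k_zm : qc Q^-1 k zm) (kV_zm : qc Q kV zm).
Hypotheses (l_x : qc Q l x) (lV_x : qc Q^-1 lV x) (l_xm : qc Q^-1 l xm).
Hypotheses (lkV : l * kV = kV * l).
Hypothesis z_zm : z * zm = ep *: (zm * z) - c *: (l - lV).

Local Notation G := (br (ep * Q) x z).
Local Notation H := (br (ep * Q^-1) zm xm).

Lemma right_xm : G * xm = - ep *: (xm * G) + ep *: (z * kV).
Proof.
rewrite (@br_mull _ _ _ x z xm (-1) ep (c *: (k - kV)) 0) ?addr0 //.
expand; rewrite k_z kV_z mul0r mulr0; expand.
lin.
Qed.

Lemma right_zm : G * zm = zm * G + Q *: (x * l).
Proof.
rewrite (@br_mull _ _ _ x z zm ep ep 0 (- c *: (l - lV))) ?addr0 //; last first.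
  by rewrite z_zm scaleNr.
expand; rewrite l_x lV_x mul0r mulr0; expand.
lin.
Qed.

Lemma right_right : G * H = - ep *: (H * G) + c *: (k * l - lV * kV).
Proof.
rewrite (@br_mulr _ _ _ G zm xm 1 (- ep) (Q *: (x * l)) (ep *: (z * kV))); first last.
- exact: right_xm.
- by rewrite right_zm scale1r.
expand; rewrite -(mulrA x l xm) l_xm -(mulrA z kV zm) kV_zm; expand.
rewrite z_zm x_xm; expand; rewrite lkV.
lin.
Qed.

Lemma right_x : x * H = - ep *: (H * x) + (ep * Q^-1) *: (zm * k).
Proof.
rewrite (@br_mulr _ _ _ x zm xm ep (-1) 0 (c *: (k - kV))) ?addr0 //.
expand; rewrite k_zm kV_zm mul0r mulr0; expand.
lin.
Qed.

End Right.
End OddNode.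

Section Cross.
Variables (K : fieldType) (A : algType K) (Q ep ep' eta : K).
Hypotheses (Q0 : Q != 0) (ep2 : ep ^+ 2 = 1).
Variables (xm kV : A).

(** The images of both neighbours contain a generator of the odd node, so they no longer commute
    letter by letter. The leftover [kV * y] produces two terms, and the factor [Q] from moving [kV]
    past [zm] makes them cancel against the parameter [ep' * Q^-1]. *)
Lemma cross_left_right E y zm : E * xm = - ep *: (xm * E) + kV * y ->
  qc (eta * ep') E zm -> qc eta y zm -> qc Q kV zm ->
  qc (- (eta * ep * ep')) E (br (ep' * Q^-1) zm xm).
Proof.
move=> E_xm E_zm y_zm kV_zm; rewrite /qc.
rewrite (@br_mulr _ _ _ E zm xm (eta * ep') (- ep) 0 (kV * y)) ?addr0 //.
expand; rewrite -(mulrA kV y) y_zm; expand; rewrite kV_zm mul0r mulr0; expand.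
lin_split K A; first [by ring | by field].
Qed.

Lemma cross_right_left G z ym : G * xm = - ep' *: (xm * G) + ep' *: (z * kV) ->
  qc (eta * ep) G ym -> qc eta z ym -> qc Q^-1 kV ym ->
  qc (- (eta * ep * ep')) G (br (ep * Q^-1) xm ym).
Proof.
move=> G_xm G_ym z_ym kV_ym; rewrite /qc.
rewrite (@br_mulr _ _ _ G xm ym (- ep') (eta * ep) (ep' *: (z * kV)) 0) ?addr0 //.
expand; rewrite -(mulrA z kV) kV_ym; expand; rewrite z_ym mul0r mulr0; expand.
lin_split K A; first [by ring: ep2 | by field: ep2].
Qed.

End Cross.

(** * Roots and the generators of Uq *)

Section Forms.
Variables (K : fieldType) (q : K) (N : nat) (s : N.-tuple bool).
Implicit Types (i j : 'I_N.-1) (a b : 'I_N) (e : bool).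

Lemma formBl u v w : Defs.form s (u - v) w = Defs.form s u w - Defs.form s v w.
Proof.
rewrite /Defs.form -sumrB; apply: eq_bigr => a _.
by rewrite !mxE mulrBr mulrBl.
Qed.

Lemma form_eps a j : Defs.form s (eps a) (alpha j) = wt s a j.
Proof.
rewrite /Defs.form (bigD1 a) //= big1 => [|b /negbTE ba].
  by rewrite /alpha /eps !mxE !eqxx mulr1 addr0 /= !natz.
by rewrite /eps mxE ba andbF mulr0 mul0r.
Qed.

(* [(alpha_i | alpha_j)] *)
Definition cw i j : int := wt s (lo i) j - wt s (hi i) j.

Lemma form_alpha i j : Defs.form s (alpha i) (alpha j) = cw i j.
Proof. by rewrite /alpha formBl !form_eps. Qed.

Lemma hi_eq_lo i j : (hi i == lo j) = (i.+1 == j :> nat).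
Proof. by []. Qed.

Lemma hi_eq_hi i j : (hi i == hi j) = (i == j).
Proof. by []. Qed.

Lemma lo_eq_lo i j : (lo i == lo j) = (i == j).
Proof. by []. Qed.

Lemma lo_eq_hi i j : (lo i == hi j) = (i == j.+1 :> nat).
Proof. by []. Qed.

Lemma cwE i j : cw i j =
  dsg s (lo i) * ((i == j)%:Z - (i == j.+1 :> nat)%:Z)
  - dsg s (hi i) * ((i.+1 == j :> nat)%:Z - (i == j)%:Z).
Proof. by rewrite /cw /wt hi_eq_lo hi_eq_hi lo_eq_lo lo_eq_hi. Qed.

Definition kk (A : algType K) (g : qgen N -> A) e j : A :=
  g (GK e (lo j)) * g (GK (~~ e) (hi j)).

Lemma aev_cartan_expr (A : algType K) (g : qgen N -> A) j :
  aev g (cartan_expr q s j) =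
  (qa q s (lo j) - (qa q s (lo j))^-1)^-1 *: (kk g true j - kk g false j).
Proof. by rewrite /= !mulr_algl scaleN1r. Qed.

Section Family.
Variables (A : algType K) (g : qgen N -> A).
Hypotheses (q0 : q != 0) (cg : cartan q s g).

Lemma kk_x e j e' j' :
  qc (q ^ (sg e * sg e' * cw j j')) (kk g e j) (g (GX e' j')).
Proof.
rewrite /cw mulrBr expfzDr //; apply: qc_mull; first exact: (cartan_kx cg).
rewrite /qc (cartan_kx cg); congr (q ^ _ *: _).
by case: e => /=; rewrite ?mulN1r ?mul1r ?mulNr ?opprK.
Qed.

Lemma kk_V e j : kk g e j * kk g (~~ e) j = 1.
Proof.
rewrite /kk negbK mulrA -(mulrA (g (GK e (lo j)))) (cartan_kk cg _ _ (hi j)).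
rewrite !mulrA (cartan_kV cg) mul1r.
by have := cartan_kV cg (~~ e) (hi j); rewrite negbK.
Qed.

Lemma kk_C e e' j j' : kk g e j * kk g e' j' = kk g e' j' * kk g e j.
Proof.
have c d d' a b : GRing.comm (g (GK d a)) (g (GK d' b)) := cartan_kk cg d d' a b.
by apply: commrM; apply/commr_sym; apply: commrM; apply: c.
Qed.

End Family.

Lemma cartan_gen : q != 0 -> cartan q s (fun x => Upi q s (EGen x)).
Proof.
move=> q0; pose g x := Upi q s (EGen x); rewrite -/g.
have rel x y : uq_rel q s x y -> aev g x = aev g y.
  by move=> xy; rewrite -!UpiE; apply/ppi_eqP/alg_rel.
have kV e a : g (GK e a) * g (GK (~~ e) a) = 1.
  by have := rel _ _ (uq_kV q s e a); rewrite /= scale1r.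
(* What commutes with [u] commutes with its inverse [v]; this carries the torus relations over to
   the k_a^-1. *)
have kVl u v w : u * v = 1 -> v * u = 1 -> w * u = u * w -> w * v = v * w :> Uq q s.
  move=> uv vu wu; rewrite -[w in LHS]mul1r -vu -(mulrA v) -wu.
  by rewrite -!mulrA uv mulr1.
have kk e e' a b : g (GK e a) * g (GK e' b) = g (GK e' b) * g (GK e a).
  have tt a' b' := rel _ _ (uq_kk q s a' b').
  have tf a' b' : g (GK true a') * g (GK false b') = g (GK false b') * g (GK true a').
    exact: (kVl _ _ _ (kV true b') (kV false b') (tt _ _)).
  case: e; case: e'; [exact: tt|exact: tf|by rewrite tf|].
  by apply: (kVl _ _ _ (kV true b) (kV false b)); rewrite tf.
have kx a e j : qc (q ^ (sg e * wt s a j)) (g (GK true a)) (g (GX e j)).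
  have := rel _ _ (uq_kx q s e a j); rewrite /= form_eps mulr_algl => h.
  have := congr1 ( *%R^~ (g (GK true a))) h.
  by rewrite -!mulrA (kV false) mulr1 -scalerAl /qc.
split=> //.
- case=> a e j; first by rewrite mul1r; apply: kx.
  rewrite [sg _]/= mulN1r mulNr -invr_expz.
  exact: (qc_V (expfz_neq0 _ q0) (kV true a) (kV false a) (kx _ _ _)).
move=> i j; have [ij|ij] := eqVneq i j.
  rewrite -ij -[aev g (cartan_expr _ _ _)](rel _ _ (uq_xx_eq q s i)).
  by rewrite /= !mulr_algl scaleN1r mulr1 addrC subrK.
have := rel _ _ (uq_xx_neq q s ij).
rewrite /= !mulr_algl scaleN1r mulr1 scale0r => /eqP; rewrite subr_eq0 => /eqP ->.
by rewrite addr0.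
Qed.

Lemma Upi_xx0 e i j : cw i j = 0 ->
  qc (ssign K (par s i) (par s j)) (Upi q s (xe K e i)) (Upi q s (xe K e j)).
Proof.
move=> ij; have h : uq_rel q s (sbr 1 (hx K s e i) (hx K s e j)).1 (EConst 0).
  by apply: uq_xx0; rewrite form_alpha.
have := (ppi_eqP _ _ _).2 (alg_rel h).
rewrite -[LHS]/(Upi q s _) -[RHS]/(Upi q s _) !UpiE /= !mulr_algl scaleN1r mulr1.
by rewrite scale0r /qc => /eqP; rewrite subr_eq0 => /eqP ->.
Qed.

End Forms.

(** * The odd reflection *)

Lemma qc_eq (K : fieldType) (A : algType K) (c c' : K) (a b : A) :
  qc c' a b -> c' = c -> qc c a b.
Proof. by move=> h <-. Qed.

Lemma qc_sq0_brr (K : fieldType) (A : algType K) (t : K) (x y : A) :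
  x * x = 0 -> qc (- t) (br t y x) x.
Proof.
rewrite /qc /br => xx; rewrite mulrBl mulrBr -!scalerAl -!scalerAr -!mulrA xx.
by rewrite (mulrA x x) xx mul0r !mulr0 !scaler0 sub0r subr0 scaleNr.
Qed.

Section Reflection.
Variables (K : fieldType) (q : K) (N : nat) (s s' : N.-tuple bool) (i : 'I_N.-1).
Implicit Types (j l : 'I_N.-1) (a b : 'I_N) (e : bool).
Hypotheses (q0 : q != 0) (q2 : q * q - 1 != 0).
Local Notation tau := (tperm (lo i) (hi i)).
Hypothesis ss' : forall a, tnth s a = tnth s' (tau a).
Hypothesis odd_i : tnth s' (lo i) != tnth s' (hi i).

Local Notation d := (dsg s' (lo i)).
Local Notation Q := (q ^ d).
(** As node [i] is odd, this is the sign for exchanging x_j with x_i. *)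
Definition psign j : K := (-1) ^+ par s' j.

Variables (A : algType K) (g : qgen N -> A).
Hypothesis cg : cartan q s' g.
Hypothesis x_sq : forall e, g (GX e i) * g (GX e i) = 0.
Hypothesis x_far : forall e j, cw s' i j = 0 ->
  qc (ssign K (par s' i) (par s' j)) (g (GX e i)) (g (GX e j)).

(** The values of [normalised_beta] in [A], as [normalised_betaE] confirms. With the signs on k_i
    and k_(i+1) twisted away, the torus part is the plain transposition [tau]. *)
Definition refl (x : qgen N) : A :=
  match x with
  | GK e a => g (GK e (tau a))
  | GX true j =>
      if j == i then (- d)%:~R *: (g (GX false i) * kk g true i)
      else if j.+1 == i :> nat then
        Q^-1 *: br (psign j * Q) (g (GX true j)) (g (GX true i))
      else if j == i.+1 :> nat then
        - 1 *: br (psign j * Q) (g (GX true i)) (g (GX true j))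
      else g (GX true j)
  | GX false j =>
      if j == i then (- d)%:~R *: (kk g false i * g (GX true i))
      else if j.+1 == i :> nat then
        Q *: br (psign j * Q^-1) (g (GX false i)) (g (GX false j))
      else if j == i.+1 :> nat then
        - 1 *: br (psign j * Q^-1) (g (GX false j)) (g (GX false i))
      else g (GX false j)
  end.

Variant position j : Prop :=
| AtNode of j = i
| AtLeft of j.+1 = i :> nat
| AtRight of j = i.+1 :> nat
| AtFar of j != i & j.+1 != i :> nat & j != i.+1 :> nat.

Lemma positionP j : position j.
Proof.
case: (eqVneq j i) => [|ji]; first exact: AtNode.
case: (eqVneq j.+1 (i : nat)) => [|jl]; first exact: AtLeft.
case: (eqVneq (j : nat) i.+1) => [|jr]; first exact: AtRight.
exact: AtFar.
Qed.

Lemma reflI e : refl (GX e i) =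
  (- d)%:~R *: (if e then g (GX false i) * kk g true i else kk g false i * g (GX true i)).
Proof. by case: e; rewrite /= eqxx. Qed.

Lemma left_neq l : l.+1 = i :> nat -> (l == i) = false.
Proof. by move=> li; rewrite -val_eqE /= -li ltn_eqF. Qed.

Lemma right_neq j : j = i.+1 :> nat -> (j == i) = false.
Proof. by move=> ji; rewrite -val_eqE /= ji gtn_eqF. Qed.

Lemma right_left_neq j : j = i.+1 :> nat -> (j.+1 == i :> nat) = false.
Proof. by move=> ->; rewrite gtn_eqF. Qed.

Lemma reflL e l : l.+1 = i :> nat -> refl (GX e l) =
  if e then Q^-1 *: br (psign l * Q) (g (GX true l)) (g (GX true i))
  else Q *: br (psign l * Q^-1) (g (GX false i)) (g (GX false l)).
Proof. by move=> li; case: e; rewrite /= left_neq // li eqxx. Qed.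

Lemma reflR e j : j = i.+1 :> nat -> refl (GX e j) =
  - 1 *: if e then br (psign j * Q) (g (GX true i)) (g (GX true j))
         else br (psign j * Q^-1) (g (GX false j)) (g (GX false i)).
Proof.
by move=> ji; case: e; rewrite /= right_neq // right_left_neq // ji eqxx.
Qed.

Lemma reflF e j : j != i -> j.+1 != i :> nat -> j != i.+1 :> nat ->
  refl (GX e j) = g (GX e j).
Proof. by move=> /negbTE h1 /negbTE h2 /negbTE h3; case: e; rewrite /= h1 h2 h3. Qed.

Lemma dsg_hi : dsg s' (hi i) = - d.
Proof. by move: odd_i; rewrite /dsg; do 2!case: (tnth _ _). Qed.

Lemma dsg_tau a : dsg s a = dsg s' (tau a).
Proof. by rewrite /dsg ss'. Qed.

Lemma par_i : par s' i = true.
Proof. by move: odd_i; rewrite /par; do 2!case: (tnth _ _). Qed.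

Lemma hi_left l : l.+1 = i :> nat -> hi l = lo i.
Proof. by move=> li; apply: val_inj. Qed.

Lemma lo_right j : j = i.+1 :> nat -> lo j = hi i.
Proof. by move=> ji; apply: val_inj. Qed.

Lemma tau_lo j : j != i -> j != i.+1 :> nat -> tau (lo j) = lo j.
Proof. by move=> ji jr; rewrite tpermD // eq_sym ?lo_eq_lo ?lo_eq_hi. Qed.

Lemma tau_hi j : j != i -> j.+1 != i :> nat -> tau (hi j) = hi j.
Proof. by move=> ji jl; rewrite tpermD // eq_sym ?hi_eq_hi ?hi_eq_lo. Qed.

Lemma tau_lo_left l : l.+1 = i :> nat -> tau (lo l) = lo l.
Proof.
by move=> li; rewrite tau_lo ?left_neq // -li ltn_eqF.
Qed.

Lemma tau_hi_right j : j = i.+1 :> nat -> tau (hi j) = hi j.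
Proof.
by move=> ji; rewrite tau_hi ?right_neq ?right_left_neq.
Qed.

Lemma wt_tau a j : wt s a j = dsg s' (tau a) *
  ((tau a == tau (lo j))%:Z - (tau a == tau (hi j))%:Z).
Proof. by rewrite /wt dsg_tau !(inj_eq perm_inj). Qed.

(** Carried along by [tau], the simple roots of [s] become - alpha_i, alpha_(i-1) + alpha_i, alpha_i
    + alpha_(i+1) and the unchanged distant roots, in terms of those of [s']; this lemma and the
    next three express it on weights. *)
Lemma wtI a : wt s a i = - wt s' (tau a) i.
Proof. by rewrite wt_tau tpermL tpermR -mulrN opprB. Qed.

Lemma wtL a l : l.+1 = i :> nat -> wt s a l = wt s' (tau a) l + wt s' (tau a) i.
Proof.
move=> li; rewrite wt_tau (hi_left li) tpermL tau_lo_left // /wt (hi_left li).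
by rewrite -mulrDr addrA subrK.
Qed.

Lemma wtR a j : j = i.+1 :> nat -> wt s a j = wt s' (tau a) i + wt s' (tau a) j.
Proof.
move=> ji; rewrite wt_tau (lo_right ji) tpermR tau_hi_right // /wt (lo_right ji).
by rewrite -mulrDr addrA subrK.
Qed.

Lemma wtF a j : j != i -> j.+1 != i :> nat -> j != i.+1 :> nat ->
  wt s a j = wt s' (tau a) j.
Proof. by move=> ji jl jr; rewrite wt_tau tau_lo ?tau_hi. Qed.

Lemma parI : par s i = true.
Proof. by rewrite /par !ss' tpermL tpermR addbC [LHS]par_i. Qed.

Lemma parL l : l.+1 = i :> nat -> par s l = ~~ par s' l.
Proof.
move=> li; rewrite /par !ss' tau_lo_left // (hi_left li) tpermL.
by move: odd_i; do 3!case: (tnth _ _).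
Qed.

Lemma parR j : j = i.+1 :> nat -> par s j = ~~ par s' j.
Proof.
move=> ji; rewrite /par !ss' tau_hi_right // (lo_right ji) tpermR.
by move: odd_i; do 3!case: (tnth _ _).
Qed.

Lemma parF j : j != i -> j.+1 != i :> nat -> j != i.+1 :> nat ->
  par s j = par s' j.
Proof. by move=> ji jl jr; rewrite /par !ss' tau_lo ?tau_hi. Qed.

Lemma cw_ii : cw s' i i = 0.
Proof. by rewrite cwE dsg_hi !eqxx (gtn_eqF (ltnSn i)) (ltn_eqF (ltnSn i)) subr0 sub0r mulr1 mulrN1 opprK subrr. Qed.

Lemma cw_il l : l.+1 = i :> nat -> cw s' i l = - d.
Proof.
move=> li; rewrite cwE eq_sym left_neq // -li eqxx gtn_eqF ?sub0r; last exact: leqW.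
by rewrite oppr0 mulr0 subr0 mulrN1.
Qed.

Lemma cw_li l : l.+1 = i :> nat -> cw s' l i = - d.
Proof.
move=> li; rewrite cwE left_neq // li eqxx ltn_eqF; last by rewrite -li ltnW.
by rewrite (hi_left li) subrr mulr0 subr0 mulr1 sub0r.
Qed.

Lemma cw_ir j : j = i.+1 :> nat -> cw s' i j = d.
Proof.
move=> ji; rewrite cwE eq_sym right_neq // ji eqxx ltn_eqF // subrr mulr0 sub0r.
by rewrite subr0 mulr1 dsg_hi opprK.
Qed.

Lemma cw_ri j : j = i.+1 :> nat -> cw s' j i = d.
Proof.
move=> ji; rewrite cwE right_neq // ji eqxx gtn_eqF // subrr mulr0 subr0 sub0r.
by rewrite (lo_right ji) dsg_hi mulrN1 opprK.
Qed.

Lemma cw_if j : j != i -> j.+1 != i :> nat -> j != i.+1 :> nat -> cw s' i j = 0.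
Proof.
move=> /negbTE ji /negbTE jl /negbTE jr.
by rewrite cwE eq_sym ji eq_sym jl eq_sym jr !subrr !mulr0 subrr.
Qed.

Lemma refl_kx e a e' j :
  qc (q ^ (sg e * sg e' * wt s a j)) (refl (GK e a)) (refl (GX e' j)).
Proof.
have kx e'' l := cartan_kx cg e (tau a) e'' l.
have kk1 e'' : qc 1 (g (GK e (tau a))) (kk g e'' i).
  by rewrite /qc scale1r /kk mulrA (cartan_kk cg) -mulrA (cartan_kk cg _ _ (tau a)) mulrA.
case: (positionP j) => [->|li|ri|ji jl jr].
- rewrite reflI wtI -[refl _](scale1r (g (GK e (tau a)))); apply: qc_scale.
  case: e' => /=; [apply: qc_eq (qc_mulr (kx _ _) (kk1 _)) _
                  |apply: qc_eq (qc_mulr (kk1 _) (kx _ _)) _];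
  by rewrite ?mul1r ?mulr1 /=; congr (q ^ _); ring.
- rewrite (reflL _ li) (wtL _ li) mulrDr expfzDr //.
  case: e' => /=; rewrite -[g (GK e (tau a))]scale1r; apply: qc_scale.
    by apply: qc_brr; apply: kx.
  by rewrite mulrC; apply: qc_brr; apply: kx.
- rewrite (reflR _ ri) (wtR _ ri) mulrDr expfzDr //.
  case: e' => /=; rewrite -[g (GK e (tau a))]scale1r; apply: qc_scale.
    by apply: qc_brr; apply: kx.
  by rewrite mulrC; apply: qc_brr; apply: kx.
by rewrite reflF // wtF //; apply: kx.
Qed.

Ltac kq h := apply: (qc_eq (kk_x q0 cg _ _ _ _)); rewrite h /= ?invr_expz;
  by congr (q ^ _); ring.

Lemma Q_neq0 : Q != 0.
Proof. exact: expfz_neq0. Qed.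

Lemma Q_sqr : Q * Q - 1 != 0.
Proof.
rewrite /dsg; case: (tnth _ _); last by rewrite expr0 expr1z.
by rewrite expr1 exprN1 -invfM subr_eq0 invr_eq1 -subr_eq0.
Qed.

Lemma psign2 j : psign j ^+ 2 = 1.
Proof. by rewrite /psign -exprM mulnC exprM sqrrN !expr1n. Qed.

Lemma psignV j : (psign j)^-1 = psign j.
Proof. by rewrite /psign; case: (par s' j); rewrite ?expr1 ?invrN ?expr0 ?invr1. Qed.

Lemma g_xx_neq j l : j != l ->
  qc (ssign K (par s' j) (par s' l)) (g (GX true j)) (g (GX false l)).
Proof. by move=> /negbTE jl; rewrite /qc (cartan_xx cg) jl addr0. Qed.

Lemma g_xx_node : g (GX true i) * g (GX false i) =
  -1 *: (g (GX false i) * g (GX true i)) + (Q - Q^-1)^-1 *: (kk g true i - kk g false i).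
Proof. by rewrite (cartan_xx cg) eqxx aev_cartan_expr par_i. Qed.

(** The signs d at [lo l] and [lo i] agree exactly when x_l is even, and (q^d - q^-d)^-1 is an odd
    function of d. *)
Lemma qa_left l : l.+1 = i :> nat ->
  (qa q s' (lo l) - (qa q s' (lo l))^-1)^-1 = psign l * (Q - Q^-1)^-1.
Proof.
move=> li; rewrite /psign /par (hi_left li) /qa /dsg.
case: (tnth _ (lo l)); case: (tnth _ (lo i));
  rewrite /= ?expr1 ?expr0 ?mul1r ?mulN1r ?exprN1 ?expr1z ?invrK //;
by rewrite -[RHS]invrN opprB.
Qed.

Lemma g_xx_left l : l.+1 = i :> nat -> g (GX true l) * g (GX false l) =
  psign l *: (g (GX false l) * g (GX true l)) +
  (psign l * (Q - Q^-1)^-1) *: (kk g true l - kk g false l).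
Proof.
move=> li; rewrite (cartan_xx cg) eqxx aev_cartan_expr qa_left //.
by rewrite /ssign andbb.
Qed.

Lemma g_xx_right j : j = i.+1 :> nat -> g (GX true j) * g (GX false j) =
  psign j *: (g (GX false j) * g (GX true j)) -
  (Q - Q^-1)^-1 *: (kk g true j - kk g false j).
Proof.
move=> ji; rewrite (cartan_xx cg) eqxx aev_cartan_expr /ssign andbb -scaleNr.
congr (_ + _ *: _); rewrite /qa (lo_right ji) dsg_hi -[RHS]invrN opprB.
by rewrite -!invr_expz invrK.
Qed.

Lemma y_xm l : l.+1 = i :> nat -> qc (psign l) (g (GX true l)) (g (GX false i)).
Proof.
move=> li; apply: (qc_eq (g_xx_neq _)); first by rewrite left_neq.
by rewrite par_i /ssign andbT.
Qed.

Lemma x_ym l : l.+1 = i :> nat -> qc (psign l) (g (GX true i)) (g (GX false l)).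
Proof.
move=> li; apply: (qc_eq (g_xx_neq _)); first by rewrite eq_sym left_neq.
by rewrite par_i /ssign.
Qed.

Lemma z_xm j : j = i.+1 :> nat -> qc (psign j) (g (GX true j)) (g (GX false i)).
Proof.
move=> ji; apply: (qc_eq (g_xx_neq _)); first by rewrite right_neq.
by rewrite par_i /ssign andbT.
Qed.

Lemma x_zm j : j = i.+1 :> nat -> qc (psign j) (g (GX true i)) (g (GX false j)).
Proof.
move=> ji; apply: (qc_eq (g_xx_neq _)); first by rewrite eq_sym right_neq.
by rewrite par_i /ssign.
Qed.

Lemma k_y l e : l.+1 = i :> nat -> qc Q^-1 (kk g e i) (g (GX e l)).
Proof. by move=> li; case: e; kq (cw_il li). Qed.

Lemma k_ym l e : l.+1 = i :> nat -> qc Q (kk g e i) (g (GX (~~ e) l)).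
Proof. by move=> li; case: e; kq (cw_il li). Qed.

Lemma l_x l e : l.+1 = i :> nat -> qc Q^-1 (kk g e l) (g (GX e i)).
Proof. by move=> li; case: e; kq (cw_li li). Qed.

Lemma l_xm l e : l.+1 = i :> nat -> qc Q (kk g e l) (g (GX (~~ e) i)).
Proof. by move=> li; case: e; kq (cw_li li). Qed.

Lemma k_z j e : j = i.+1 :> nat -> qc Q (kk g e i) (g (GX e j)).
Proof. by move=> ji; case: e; kq (cw_ir ji). Qed.

Lemma k_zm j e : j = i.+1 :> nat -> qc Q^-1 (kk g e i) (g (GX (~~ e) j)).
Proof. by move=> ji; case: e; kq (cw_ir ji). Qed.

Lemma m_x j e : j = i.+1 :> nat -> qc Q (kk g e j) (g (GX e i)).
Proof. by move=> ji; case: e; kq (cw_ri ji). Qed.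

Lemma m_xm j e : j = i.+1 :> nat -> qc Q^-1 (kk g e j) (g (GX (~~ e) i)).
Proof. by move=> ji; case: e; kq (cw_ri ji). Qed.

Lemma k_x e e' : qc 1 (kk g e i) (g (GX e' i)).
Proof. by apply: (qc_eq (kk_x q0 cg _ _ _ _)); rewrite cw_ii mulr0 expr0z. Qed.

Section LeftRelations.
Variable l : 'I_N.-1.
Hypothesis li : l.+1 = i :> nat.
Local Notation E := (br (psign l * Q) (g (GX true l)) (g (GX true i))).
Local Notation F := (br (psign l * Q^-1) (g (GX false i)) (g (GX false l))).

Lemma leftE_xm :
  E * g (GX false i) = - psign l *: (g (GX false i) * E) + kk g false i * g (GX true l).
Proof.
exact: (left_xm Q_neq0 Q_sqr (psign2 l) g_xx_node (y_xm li) (k_y true li) (k_ym false li)).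
Qed.

Lemma leftE_F : E * F = - psign l *: (F * E) +
  (psign l * (Q - Q^-1)^-1) *: (kk g true l * kk g true i - kk g false i * kk g false l).
Proof.
exact: (left_left Q_neq0 Q_sqr (psign2 l) g_xx_node (y_xm li) (x_ym li)
  (k_y true li) (k_ym false li) (k_y false li)
  (l_x true li) (l_xm false li) (l_xm true li) (kk_C cg _ _ _ _) (g_xx_left li)).
Qed.

Lemma left_x_F : g (GX true i) * F = - psign l *: (F * g (GX true i)) + g (GX false l) * kk g true i.
Proof.
exact: (left_x Q_neq0 Q_sqr (psign2 l) g_xx_node (x_ym li) (k_ym true li) (k_y false li)).
Qed.

End LeftRelations.

Section RightRelations.
Variable j : 'I_N.-1.
Hypothesis ji : j = i.+1 :> nat.
Local Notation G := (br (psign j * Q) (g (GX true i)) (g (GX true j))).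
Local Notation H := (br (psign j * Q^-1) (g (GX false j)) (g (GX false i))).

Lemma rightG_xm :
  G * g (GX false i) = - psign j *: (g (GX false i) * G) + psign j *: (g (GX true j) * kk g false i).
Proof.
exact: (right_xm Q_neq0 Q_sqr (psign2 j) g_xx_node (z_xm ji) (k_z true ji) (k_zm false ji)).
Qed.

Lemma rightG_H : G * H = - psign j *: (H * G) +
  (Q - Q^-1)^-1 *: (kk g true i * kk g true j - kk g false j * kk g false i).
Proof.
exact: (right_right Q_neq0 Q_sqr (psign2 j) g_xx_node (z_xm ji) (x_zm ji)
  (k_z true ji) (k_zm false ji) (k_z false ji)
  (m_x true ji) (m_xm false ji) (m_xm true ji) (kk_C cg _ _ _ _) (g_xx_right ji)).
Qed.

Lemma right_x_H : g (GX true i) * H =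
  - psign j *: (H * g (GX true i)) + (psign j * Q^-1) *: (g (GX false j) * kk g true i).
Proof.
exact: (right_x Q_neq0 Q_sqr (psign2 j) g_xx_node (x_zm ji) (k_zm true ji) (k_z false ji)).
Qed.

End RightRelations.

(** * The Cartan relations for the reflected generators *)

Lemma refl_kk e j : kk refl e j =
  g (GK e (tau (lo j))) * g (GK (~~ e) (tau (hi j))).
Proof. by []. Qed.

Lemma kk_commute e e' a b : g (GK e a) * g (GK e' b) = g (GK e' b) * g (GK e a).
Proof. exact: (cartan_kk cg). Qed.

Lemma refl_kkI e : kk refl e i = kk g (~~ e) i.
Proof. by rewrite refl_kk tpermL tpermR kk_commute /kk negbK. Qed.

Lemma refl_kkL e l : l.+1 = i :> nat -> kk refl e l = kk g e l * kk g e i.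
Proof.
move=> li; rewrite refl_kk tau_lo_left // (hi_left li) tpermL /kk (hi_left li).
rewrite mulrA -(mulrA (g (GK e (lo l)))).
by have := cartan_kV cg (~~ e) (lo i); rewrite negbK => ->; rewrite mulr1.
Qed.

Lemma refl_kkR e j : j = i.+1 :> nat -> kk refl e j = kk g e i * kk g e j.
Proof.
move=> ji; rewrite refl_kk tau_hi_right // (lo_right ji) tpermR /kk (lo_right ji).
rewrite mulrA -(mulrA (g (GK e (lo i)))).
by have := cartan_kV cg (~~ e) (hi i); rewrite negbK => ->; rewrite mulr1.
Qed.

Lemma refl_kkF e j : j != i -> j.+1 != i :> nat -> j != i.+1 :> nat ->
  kk refl e j = kk g e j.
Proof. by move=> ji jl jr; rewrite refl_kk tau_lo ?tau_hi. Qed.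

Lemma sgK2 : (- d)%:~R * (- d)%:~R = 1 :> K.
Proof. by rewrite -intrM mulrNN dsg_sqr. Qed.

(** Since (alpha_i | alpha_i) = 0, the torus factors commute with x_i^+ and x_i^- and cancel in both
    products: the relation is that of [g] with raising and lowering exchanged. The Cartan difference
    and its denominator both change sign. *)
Lemma refl_xx_II : refl (GX true i) * refl (GX false i) =
  -1 *: (refl (GX false i) * refl (GX true i)) + aev refl (cartan_expr q s i).
Proof.
rewrite aev_cartan_expr !refl_kkI !reflI -!scalerAl -!scalerAr !scalerA sgK2.
have kx e e' : kk g e i * g (GX e' i) = g (GX e' i) * kk g e i.
  by rewrite k_x scale1r.
rewrite mulrA -(mulrA (g (GX false i))) (kk_V cg) mulr1.
rewrite kx -(kx true) -(mulrA (g (GX true i))) (mulrA (kk g false i)) (kk_V cg false).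
rewrite mul1r g_xx_node /qa dsg_tau tpermL dsg_hi -invr_expz invrK -opprB invrN.
by rewrite -(mulrA (-1)) sgK2; lin_split K A; ring.
Qed.

Lemma ssignV e e' : (ssign K e e')^-1 = ssign K e e'.
Proof. by case: e; case: e'; rewrite /ssign ?expr1 ?expr0 ?invrN ?invr1. Qed.

Lemma ssign_neq0 e e' : ssign K e e' != 0.
Proof. by rewrite /ssign signr_eq0. Qed.

Lemma x_far_sym e j : j != i -> j.+1 != i :> nat -> j != i.+1 :> nat ->
  qc (ssign K (par s' i) (par s' j)) (g (GX e j)) (g (GX e i)).
Proof.
move=> ji jl jr; rewrite -[ssign _ _ _]ssignV; apply: qc_sym (ssign_neq0 _ _) _.
by apply: x_far; rewrite cw_if.
Qed.

Lemma k_far e e' j : j != i -> j.+1 != i :> nat -> j != i.+1 :> nat ->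
  qc 1 (kk g e i) (g (GX e' j)).
Proof.
by move=> ji jl jr; apply: (qc_eq (kk_x q0 cg _ _ _ _)); rewrite cw_if // mulr0 expr0z.
Qed.

Lemma k_far_sym e e' j : j != i -> j.+1 != i :> nat -> j != i.+1 :> nat ->
  qc 1 (g (GX e' j)) (kk g e i).
Proof.
by move=> ji jl jr; rewrite -[1]invr1; apply: qc_sym (oner_neq0 _) (k_far _ _ _ _ _).
Qed.

Ltac signs := rewrite ?parI ?par_i /psign /ssign;
  repeat match goal with |- context [par ?t ?j] => case: (par t j) end;
  rewrite /= ?expr1 ?expr0 ?mul1r ?mulr1 ?mulrN1 ?mulN1r ?opprK //.

(** Node against neighbour: the power of Q from the bracket with a square-zero element cancels the
    one from the torus factor. Left against right is the [Cross] computation. In the remaining cases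
    each letter of one image commutes up to a scalar with each letter of the other. *)
Lemma refl_xx_neq j l : j != l ->
  qc (ssign K (par s j) (par s l)) (refl (GX true j)) (refl (GX false l)).
Proof.
have QV := mulVf Q_neq0; have QV' := mulfV Q_neq0.
case: (positionP j) (positionP l) => [->|jl|jr|ji jl jr] [->|ll|lr|li ll lr] jneq.
- by rewrite eqxx in jneq.
- rewrite reflI (reflL _ ll) (parL ll); apply: qc_scale.
  apply: (qc_eq (qc_mull (qc_sq0_brl _ _ (x_sq false))
    (qc_brr _ (k_x true false) (k_ym true ll)))).
  by rewrite mul1r mulNr -mulrA QV; signs.
- rewrite reflI (reflR _ lr) (parR lr); apply: qc_scale.
  have t0 : - (psign l * Q^-1) != 0 by rewrite oppr_eq0 mulf_neq0 ?invr_eq0 ?Q_neq0 ?signr_eq0.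
  apply: (qc_eq (qc_mull (qc_sym t0 (qc_sq0_brr _ _ (x_sq false)))
    (qc_brr _ (k_zm true lr) (k_x true false)))).
  by rewrite mulr1 invrN invfM invrK psignV mulNr -mulrA QV'; signs.
- rewrite reflI reflF // (parF li ll lr); rewrite -[g (GX false l)]scale1r; apply: qc_scale.
  apply: (qc_eq (qc_mull (x_far _ _) (k_far _ _ li ll lr))); first exact: cw_if.
  by rewrite mulr1; signs.
- rewrite reflI (reflL _ jl) (parL jl); apply: qc_scale.
  have E := qc_brr (psign j * Q) (k_ym false jl) (k_x false true).
  rewrite mulr1 in E; have {}E := qc_sym Q_neq0 E.
  apply: (qc_eq (qc_mulr E (qc_sq0_brr _ _ (x_sq true)))).
  by rewrite mulrN mulrCA QV; signs.
- by case/eqP: jneq; apply: val_inj; apply: succn_inj; rewrite jl ll.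
- rewrite (reflL _ jl) (reflR _ lr) (parL jl) (parR lr); apply: qc_scale.
  have ni : i != l by rewrite eq_sym right_neq.
  apply: (qc_eq (cross_left_right (eta := ssign K (par s' j) (par s' l)) (ep' := psign l)
    Q_neq0 (leftE_xm jl) _ (g_xx_neq jneq) (k_z false lr))).
  + by apply: (qc_eq (qc_brl _ (g_xx_neq jneq) (g_xx_neq ni))); signs.
  by signs.
- rewrite (reflL _ jl) reflF // (parL jl) (parF li ll lr).
  rewrite -[g (GX false l)]scale1r; apply: qc_scale.
  have ni : i != l by rewrite eq_sym.
  by apply: (qc_eq (qc_brl _ (g_xx_neq jneq) (g_xx_neq ni))); signs.
- rewrite reflI (reflR _ jr) (parR jr); apply: qc_scale.
  have E := qc_brr (psign j * Q) (k_x false true) (k_zm false jr).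
  rewrite mul1r in E; have {}E := qc_sym (invr_neq0 Q_neq0) E.
  have t0 : - (psign j * Q) != 0 by rewrite oppr_eq0 mulf_neq0 ?Q_neq0 ?signr_eq0.
  apply: (qc_eq (qc_mulr E (qc_sym t0 (qc_sq0_brl _ _ (x_sq true))))).
  by rewrite invrK invrN invfM psignV mulrN mulrCA QV'; signs.
- rewrite (reflL _ ll) (reflR _ jr) (parL ll) (parR jr); apply: qc_scale.
  have ni : i != l by rewrite eq_sym left_neq.
  apply: (qc_eq (cross_right_left (eta := ssign K (par s' j) (par s' l)) (ep := psign l)
    (psign2 l) (rightG_xm jr) _ (g_xx_neq jneq) (k_y false ll))).
  + by apply: (qc_eq (qc_brl _ (g_xx_neq ni) (g_xx_neq jneq))); signs.
  by signs.
- by case/eqP: jneq; apply: val_inj; rewrite /= jr lr.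
- rewrite (reflR _ jr) reflF // (parR jr) (parF li ll lr).
  rewrite -[g (GX false l)]scale1r; apply: qc_scale.
  have ni : i != l by rewrite eq_sym.
  by apply: (qc_eq (qc_brl _ (g_xx_neq ni) (g_xx_neq jneq))); signs.
- rewrite reflI reflF // (parF ji jl jr); rewrite -[g (GX true j)]scale1r; apply: qc_scale.
  apply: (qc_eq (qc_mulr (k_far_sym _ _ ji jl jr) (x_far_sym _ ji jl jr))).
  by rewrite mul1r; signs.
- rewrite (reflL _ ll) reflF // (parL ll) (parF ji jl jr).
  rewrite -[g (GX true j)]scale1r; apply: qc_scale.
  by apply: (qc_eq (qc_brr _ (g_xx_neq ji) (g_xx_neq jneq))); signs.
- rewrite (reflR _ lr) reflF // (parR lr) (parF ji jl jr).
  rewrite -[g (GX true j)]scale1r; apply: qc_scale.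
  by apply: (qc_eq (qc_brr _ (g_xx_neq jneq) (g_xx_neq ji))); signs.
by rewrite !reflF // !parF //; apply: g_xx_neq.
Qed.

Lemma refl_xx j l : refl (GX true j) * refl (GX false l) =
  ssign K (par s j) (par s l) *: (refl (GX false l) * refl (GX true j)) +
  (if j == l then aev refl (cartan_expr q s j) else 0).
Proof.
have [<-{l}|jl] := eqVneq j l; last by rewrite addr0; exact: refl_xx_neq.
have QV := mulVf Q_neq0.
case: (positionP j) => [->|jl|jr|ji jl jr].
- by rewrite refl_xx_II parI /ssign expr1.
- rewrite !(reflL _ jl) (parL jl) aev_cartan_expr !(refl_kkL _ jl).
  rewrite -!scalerAl -!scalerAr !(scalerA Q^-1) !(scalerA Q) mulfV ?Q_neq0 //.
  rewrite QV !scale1r (leftE_F jl) (kk_C cg false false); congr (_ *: _ + _ *: _).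
    by signs.
  by rewrite -(qa_left jl) /qa dsg_tau tau_lo_left.
- rewrite !(reflR _ jr) (parR jr) aev_cartan_expr !(refl_kkR _ jr).
  rewrite -!scalerAl -!scalerAr !scalerA !mulrN1 !opprK scale1r.
  rewrite (rightG_H jr) (kk_C cg false false); congr (_ *: _ + _ *: _).
    by signs.
  by rewrite /qa dsg_tau (lo_right jr) tpermR.
rewrite !reflF // parF // (cartan_xx cg) eqxx !aev_cartan_expr !refl_kkF //.
by rewrite /qa dsg_tau tau_lo.
Qed.

Lemma cartan_refl : cartan q s refl.
Proof.
split=> [e a|e e' a b|e a e' j|j l].
- exact: (cartan_kV cg).
- exact: (cartan_kk cg).
- exact: refl_kx.
- exact: refl_xx.
Qed.

(** * Surjectivity of the reflection *)

Definition reached (u : A) : Prop := exists y, aev refl y = u.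

Lemma reached_gen x : reached (refl x).
Proof. by exists (EGen x). Qed.

Lemma reachedD u v : reached u -> reached v -> reached (u + v).
Proof. by move=> [x <-] [y <-]; exists (x + y)%nc. Qed.

Lemma reachedM u v : reached u -> reached v -> reached (u * v).
Proof. by move=> [x <-] [y <-]; exists (x * y)%nc. Qed.

Lemma reachedZ c u : reached u -> reached (c *: u).
Proof. by move=> [x <-]; exists (EMul (EConst c) x); rewrite /= mulr_algl. Qed.

Lemma reached_kk e : reached (kk g e i).
Proof.
rewrite -[e]negbK -refl_kkI; apply: reachedM; exact: reached_gen.
Qed.

Lemma reached_node e : reached (g (GX e i)).
Proof.
have -> : g (GX e i) = (- d)%:~R *:
    (if e then kk g true i * refl (GX false i) else refl (GX true i) * kk g false i).
  case: e; rewrite reflI -?scalerAr -?scalerAl scalerA sgK2 scale1r.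
    by rewrite mulrA (kk_V cg true) mul1r.
  by rewrite -mulrA (kk_V cg true) mulr1.
apply: reachedZ; case: e; apply: reachedM; by [apply: reached_kk|apply: reached_gen].
Qed.

(** [leftE_xm] and [left_x_F] are solved for the term that contains the original generator, and the
    invertible torus factor is then removed. [reached_right] proceeds in the same way. *)
Lemma reached_left e l : l.+1 = i :> nat -> reached (g (GX e l)).
Proof.
move=> li; have x e' := reached_node e'.
have rE : reached (br (psign l * Q) (g (GX true l)) (g (GX true i))).
  have := reached_gen (GX true l); rewrite (reflL _ li) => /(reachedZ Q).
  by rewrite scalerA mulfV ?Q_neq0 // scale1r.
have rF : reached (br (psign l * Q^-1) (g (GX false i)) (g (GX false l))).
  have := reached_gen (GX false l); rewrite (reflL _ li) => /(reachedZ Q^-1).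
  by rewrite scalerA mulVf ?Q_neq0 // scale1r.
case: e.
  have /esym/eqP := leftE_xm li; rewrite addrC eq_sym -subr_eq => /eqP h.
  rewrite -[g _]mul1r -(kk_V cg true i) -mulrA -h -scaleNr.
  apply: reachedM; first exact: reached_kk.
  by apply: reachedD; [apply: reachedM|apply/reachedZ/reachedM].
have /esym/eqP := left_x_F li; rewrite addrC eq_sym -subr_eq => /eqP h.
rewrite -[g _]mulr1 -(kk_V cg true i) mulrA -h -scaleNr.
apply: reachedM; last exact: reached_kk.
by apply: reachedD; [apply: reachedM|apply/reachedZ/reachedM].
Qed.

Lemma reached_right e j : j = i.+1 :> nat -> reached (g (GX e j)).
Proof.
move=> ji; have x e' := reached_node e'.
have rG : reached (br (psign j * Q) (g (GX true i)) (g (GX true j))).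
  have := reached_gen (GX true j); rewrite (reflR _ ji) => /(reachedZ (- 1)).
  by rewrite scalerA mulrNN mulr1 scale1r.
have rH : reached (br (psign j * Q^-1) (g (GX false j)) (g (GX false i))).
  have := reached_gen (GX false j); rewrite (reflR _ ji) => /(reachedZ (- 1)).
  by rewrite scalerA mulrNN mulr1 scale1r.
have p0 : psign j != 0 by rewrite signr_eq0.
case: e.
  have /esym/eqP := rightG_xm ji; rewrite addrC eq_sym -subr_eq => /eqP h.
  rewrite -[g _]mulr1 -(kk_V cg false i) mulrA -(scalerK p0 (_ * kk g false i)) -h -scaleNr.
  apply: reachedM; last exact: reached_kk.
  by apply/reachedZ/reachedD; [apply: reachedM|apply/reachedZ/reachedM].
have p1 : psign j * Q^-1 != 0 by rewrite mulf_neq0 // invr_neq0 // Q_neq0.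
have /esym/eqP := right_x_H ji; rewrite addrC eq_sym -subr_eq => /eqP h.
rewrite -[g _]mulr1 -(kk_V cg true i) mulrA -(scalerK p1 (_ * kk g true i)) -h -scaleNr.
apply: reachedM; last exact: reached_kk.
by apply/reachedZ/reachedD; [apply: reachedM|apply/reachedZ/reachedM].
Qed.

Lemma refl_surj x : exists y, aev refl y = aev g x.
Proof.
elim: x => [[e j|e a]|c|x IHx y IHy|x IHx y IHy].
- case: (positionP j) => [->|jl|jr|ji jl jr] /=.
  + exact: reached_node.
  + exact: reached_left.
  + exact: reached_right.
  + by exists (EGen (GX e j)); rewrite -reflF.
- by exists (EGen (GK e (tau a))); rewrite /= tpermK.
- by exists (EConst c).
- exact: reachedD.
- exact: reachedM.
Qed.

(** * The maximal vector for the reflected generators *)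

Section HighestWeight.
Variables (W : lmodType A) (lam : 'I_N -> K) (zeta : W).
Hypothesis hzeta : hwvec g lam zeta.
Hypothesis lam_i : (lam (lo i) / lam (hi i)) ^+ 2 != 1.

Let eta := g (GX false i) *: zeta.

Lemma kk_zeta e : kk g e i *: zeta =
  ((lam (lo i) / lam (hi i)) ^ sg e)%:A *: zeta.
Proof.
have -> : (lam (lo i) / lam (hi i)) ^ sg e =
    lam (hi i) ^ sg (~~ e) * lam (lo i) ^ sg e.
  by case: e => /=; rewrite ?expr1z ?exprN1 ?invf_div mulrC.
by rewrite /kk -scalerA (hw_kV _ _ cg hzeta) algC (hw_kV _ _ cg hzeta) algZZ.
Qed.

Lemma x_eta : g (GX true i) *: eta =
  ((Q - Q^-1)^-1 * (lam (lo i) / lam (hi i) - (lam (lo i) / lam (hi i))^-1))%:A *: zeta.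
Proof.
rewrite /eta scalerA g_xx_node scalerDl (algZ (-1) (_ * _)) -(scalerA (g _)).
rewrite (hw_x hzeta) !scaler0 add0r algZ scalerBl !kk_zeta /= expr1z exprN1.
by rewrite -scalerBl -scalerBl algZZ.
Qed.

Lemma x_eta_neq0 :
  (Q - Q^-1)^-1 * (lam (lo i) / lam (hi i) - (lam (lo i) / lam (hi i))^-1) != 0.
Proof.
have l0 : lam (lo i) / lam (hi i) != 0.
  by rewrite mulf_neq0 ?invr_neq0 ?(hw_lam_neq0 _ cg hzeta).
apply: mulf_neq0.
  rewrite invr_eq0; apply: contraNneq Q_sqr => h.
  by rewrite -[1](mulfV Q_neq0) -mulrBr h mulr0.
by apply: contraNneq lam_i => /eqP; rewrite subr_eq0 => /eqP h; rewrite expr2 {1}h mulVf.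
Qed.

Lemma hwvec_refl : hwvec refl (fun a => q ^ (- wt s' (tau a) i) * lam (tau a)) eta.
Proof.
have x_z j := hw_x hzeta j.
split=> [||a].
- apply: contraNneq (hw_neq0 hzeta) => e0; apply/eqP; apply: (alg_eq0 x_eta_neq0).
  by rewrite -x_eta e0 scaler0.
- move=> j; case: (positionP j) => [->|jl|jr|ji jl jr].
  (* The image of x_i^+ is a multiple of x_i^- times a torus element, and x_i^- squares to zero. *)
  + rewrite reflI algZ -scalerA /eta (scalerA (kk _ _ _)) k_x scale1r -scalerA.
    by rewrite (scalerA (g _)) x_sq scale0r scaler0.
  (* In the bracket applied to [eta], x_j^+ x_i^+ [eta] is a multiple of x_j^+ [zeta], and x_i^+
     x_j^+ [eta] is up to sign x_i^+ x_i^- x_j^+ [zeta]; both vanish. *)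
  + have ni : j != i by rewrite left_neq.
    rewrite (reflL _ jl) algZ /br scalerBl (algZ (_ * _)) -!(scalerA (g _)) x_eta algC x_z scaler0.
    rewrite /eta (scalerA (g (GX true j))) (g_xx_neq ni) (algZ (ssign _ _ _)) -(scalerA (g _)) x_z.
    by rewrite !scaler0 subr0 scaler0.
  + have ni : j != i by rewrite right_neq.
    rewrite (reflR _ jr) algZ /br scalerBl (algZ (_ * _)) -!(scalerA (g _)) x_eta algC x_z scaler0.
    rewrite /eta (scalerA (g (GX true j))) (g_xx_neq ni) (algZ (ssign _ _ _)) -(scalerA (g _)) x_z.
    by rewrite !scaler0 subr0 scaler0.
  by rewrite reflF // /eta scalerA (g_xx_neq ji) algZ -scalerA x_z !scaler0.
rewrite /= /eta scalerA (cartan_kx cg) algZ -scalerA (hw_k hzeta) algC algZZ /=.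
by rewrite mul1r mulN1r.
Qed.

End HighestWeight.

End Reflection.

(** * Agreement with the normalised odd reflection *)

Lemma aev_ext (K : fieldType) (A : algType K) (G : Type) (g h : G -> A) x :
  g =1 h -> aev g x = aev h x.
Proof. by move=> gh; elim: x => //= x -> y ->. Qed.

Section NormalisedBeta.
Variables (K : fieldType) (q : K) (N : nat) (s : N.-tuple bool) (i : 'I_N.-1).
Variables (A : algType K) (g : qgen N -> A).
Hypothesis cg : cartan q s g.
Hypothesis odd_i : tnth s (lo i) != tnth s (hi i).

Lemma beta_sign_lo : beta_sign s i (lo i) = - dsg s (lo i).
Proof. by rewrite /beta_sign eqxx (dsg_hi odd_i). Qed.

Lemma beta_sign_hi : beta_sign s i (hi i) = dsg s (lo i).
Proof. by rewrite /beta_sign eq_sym lo_neq_hi eqxx. Qed.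

Lemma beta_sign1 a : a != lo i -> a != hi i -> beta_sign s i a = 1.
Proof. by rewrite /beta_sign => /negbTE -> /negbTE ->. Qed.

Lemma dsgK2 : (dsg s (lo i))%:~R ^+ 2 = 1 :> K.
Proof. by rewrite expr2 -intrM dsg_sqr. Qed.

(** The signs of [beta] and of the twist combine to those of [refl] by d_i^2 = 1, which is passed to
    [ring] as [d2]. *)
Lemma normalised_betaE x : aev g (normalised_beta q s i x) = refl q s i g x.
Proof.
have d2 := dsgK2.
have bl := beta_sign_lo; have bh := beta_sign_hi.
rewrite /normalised_beta; case: x => [[] j|e a] /=.
- case: (positionP i j) => [->|jl|jr|ji jl jr].
  + rewrite !eqxx /= bl bh !mulr_algl !(dsg_hi odd_i) opprK !rmorphN /= /kk /=.
    do 3!rewrite -?scalerAl -?scalerAr; rewrite -?mulrA; lin_split K A; by ring: d2.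
  + have pj : tnth s (lo j) (+) tnth s (lo i) = par s j by rewrite /par (hi_left jl).
    rewrite left_neq // jl eqxx /= (hi_left jl) bl bh !mulr_algl.
    rewrite beta_sign1 ?lo_eq_lo ?lo_eq_hi ?left_neq // -?jl ?ltn_eqF //.
    rewrite pj [_ (+) tnth s (hi i)](par_i odd_i) andbT /br -/(psign K s j).
    rewrite -invr_expz !rmorphM !rmorphN /= rmorph1.
    move: (psign K s j) (q ^ _) => p Q.
    do 3!rewrite -?scalerAl -?scalerAr; rewrite ?mulrA; lin_split K A; by ring: d2.
  + have pj : tnth s (hi i) (+) tnth s (hi j) = par s j by rewrite /par (lo_right jr).
    rewrite right_neq // right_left_neq // jr eqxx /= (lo_right jr) bl bh !mulr_algl.
    rewrite (@beta_sign1 (hi j)) ?hi_eq_lo ?hi_eq_hi ?right_neq ?right_left_neq //.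
    rewrite pj [tnth s (lo i) (+) _](par_i odd_i) /= /br -/(psign K s j).
    rewrite (dsg_hi odd_i) opprK !rmorphM !rmorphN /= rmorph1.
    move: (psign K s j) (q ^ _) => p Q.
    do 3!rewrite -?scalerAl -?scalerAr; rewrite ?mulrA; lin_split K A; by ring: d2.
  rewrite (negbTE ji) (negbTE jl) (negbTE jr) /=.
  have lo1 : beta_sign s i (lo j) = 1 by rewrite beta_sign1 ?lo_eq_lo ?lo_eq_hi.
  have hi1 : beta_sign s i (hi j) = 1 by rewrite beta_sign1 ?hi_eq_lo ?hi_eq_hi.
  by rewrite lo1 hi1 mulr1 !scale1r mul1r.
- case: (positionP i j) => [->|jl|jr|ji jl jr].
  + rewrite !eqxx /= bl bh !mulr_algl /kk (kk_commute cg) /= rmorphM !rmorphN /=.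
    do 3!rewrite -?scalerAl -?scalerAr; rewrite -?mulrA; lin_split K A; by ring: d2.
  + have pj : tnth s (lo j) (+) tnth s (lo i) = par s j by rewrite /par (hi_left jl).
    rewrite left_neq // jl eqxx /= (hi_left jl) !mulr_algl pj.
    rewrite [_ (+) tnth s (hi i)](par_i odd_i) /br -/(psign K s j) -invr_expz.
    move: (psign K s j) (q ^ _) => p Q; lin_split K A; by ring.
  + have pj : tnth s (hi i) (+) tnth s (hi j) = par s j by rewrite /par (lo_right jr).
    rewrite right_neq // right_left_neq // jr eqxx /= (lo_right jr) !mulr_algl pj.
    rewrite [tnth s (lo i) (+) _](par_i odd_i) andbT /br -/(psign K s j).
    rewrite (dsg_hi odd_i) -invr_expz.
    move: (psign K s j) (q ^ _) => p Q; lin_split K A; by ring.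
  by rewrite (negbTE ji) (negbTE jl) (negbTE jr).
case: tpermP => [->|->|/eqP al /eqP ah].
- by rewrite eqxx /= bh !mulr_algl scalerA -expr2 d2 scale1r.
- rewrite eq_sym lo_neq_hi eqxx /= bl !mulr_algl scalerA (dsg_hi odd_i) -expr2.
  by rewrite rmorphN sqrrN d2 scale1r.
by rewrite (negbTE al) (negbTE ah) /= beta_sign1 // scale1r mul1r.
Qed.

End NormalisedBeta.

Lemma simple_cyclic (A : pzRingType) (V : lmodType A) (v w : V) :
  simple_module V -> v != 0 -> exists u, w = u *: v.
Proof.
move=> [_ simpleV] v0.
pose S := [pred w : V | `[< exists u, w = u *: v >]].
have clS : GRing.submod_closed S.
  split=> [|a x y /asboolP[c ->] /asboolP[d ->]]; apply/asboolP.
    by exists 0; rewrite scale0r.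
  by exists (a * c + d); rewrite scalerDl scalerA.
case: (simpleV S clS) => [S0|ST].
  have /eqP := v0; case; apply: S0; apply/asboolP.
  by exists 1; rewrite scale1r.
by have /asboolP := ST w.
Qed.

(** The first hypothesis replaces each acting element of [A] by an expression; for the reflected
    family it is the surjectivity of the reflection. *)
Lemma simple_hw_simple (K : fieldType) N (A : algType K) (g : qgen N -> A)
    (V : lmodType A) (zeta : V) :
  (forall u, exists x, aev g x = u) -> simple_module V -> zeta != 0 ->
  hw_simple g zeta.
Proof.
move=> gs simV z0; split=> v => [|v0].
  have [u ->] := simple_cyclic v simV z0.
  by have [x <-] := gs u; exists x.
have [u ->] := simple_cyclic zeta simV v0.
by have [x <-] := gs u; exists x.
Qed.

(** * Complex powers of q *)

Section QPowers.
Variable R : realType.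
Local Notation C := R[i].
Implicit Types z w : C.

Lemma cexpD z w : cexp (z + w) = cexp z * cexp w.
Proof.
case: z w => [a b] [c d]; rewrite /cexp /= expRD cosD sinD.
by apply/eqP; rewrite eq_complex /=; apply/andP; split; apply/eqP; ring.
Qed.

Lemma cexp0 : cexp (0 : C) = 1.
Proof. by rewrite /cexp /= expR0 cos0 sin0 mulr1 mulr0. Qed.

Variables (logq q : C).
Hypotheses (exp_logq : cexp logq = q) (q0 : q != 0).

Lemma qpowD z w : qpow logq (z + w) = qpow logq z * qpow logq w.
Proof. by rewrite /qpow mulrDl cexpD. Qed.

Lemma qpow0 : qpow logq 0 = 1.
Proof. by rewrite /qpow mul0r cexp0. Qed.

Lemma qpowN z : qpow logq (- z) = (qpow logq z)^-1.
Proof.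
have h : qpow logq (- z) * qpow logq z = 1 by rewrite -qpowD addNr qpow0.
have z0 : qpow logq z != 0.
  by apply: contra_eq_neq h => ->; rewrite mulr0 eq_sym oner_neq0.
by rewrite -[RHS]mul1r -h mulfK.
Qed.

Lemma qpow_nat (n : nat) : qpow logq n%:R = q ^+ n.
Proof.
elim: n => [|n IH]; first by rewrite qpow0.
by rewrite -addn1 natrD qpowD IH exprD /qpow mul1r exp_logq.
Qed.

Lemma qpow_int (n : int) : qpow logq n%:~R = q ^ n.
Proof.
case: n => n; first exact: qpow_nat.
by rewrite NegzE rmorphN /= qpowN -pmulrn qpow_nat -exprnN.
Qed.

End QPowers.

Lemma hwvec_eq (K : fieldType) N (A : algType K) (g : qgen N -> A)
    (V : lmodType A) (lam mu : 'I_N -> K) (zeta : V) :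
  lam =1 mu -> hwvec g lam zeta -> hwvec g mu zeta.
Proof. by move=> lm [z0 zx zk]; split=> // a; rewrite zk lm. Qed.

Lemma highest_weight_hwvec (K : fieldType) (q : K) N (s : N.-tuple bool)
    (V : lmodType (Uq q s)) (lam : 'I_N -> K) (zeta : V) :
  highest_weight lam zeta -> hwvec (fun x => Upi q s (EGen x)) lam zeta.
Proof. by case. Qed.

Lemma UpiP (K : fieldType) (q : K) N (s : N.-tuple bool) (u : Uq q s) :
  exists x, aev (fun y => Upi q s (EGen y)) x = u.
Proof. by exists (repr u); rewrite -UpiE; exact: ppi_repr. Qed.

(** * The reflected weight *)

Section Weights.
Variables (R : realType) (q logq : R[i]).
Hypotheses (q0 : q != 0) (exp_logq : cexp logq = q).
Variables (N : nat) (s : N.-tuple bool) (i : 'I_N.-1).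
Hypothesis odd_i : tnth s (lo i) != tnth s (hi i).
Variable Lam : 'I_N -> R[i].
Local Notation mu := (reflected_weight logq s i Lam).

Lemma tnth_swap a : tnth s a = tnth (swap s i) (tperm (lo i) (hi i) a).
Proof. by rewrite tnth_mktuple tpermK. Qed.

Lemma swap_odd : tnth (swap s i) (lo i) != tnth (swap s i) (hi i).
Proof. by rewrite !tnth_mktuple tpermL tpermR eq_sym. Qed.

Lemma reflected_weight_lo : mu (lo i) = qapow logq s (hi i) (Lam (hi i) + 1).
Proof. by rewrite /reflected_weight eqxx. Qed.

Lemma reflected_weight_hi : mu (hi i) = qapow logq s (lo i) (Lam (lo i) - 1).
Proof. by rewrite /reflected_weight eq_sym lo_neq_hi eqxx. Qed.

(** The power of q in front is what x_i^- contributes to the weight of [eta]; it cancels the shifts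
    by 1 and -1. *)
Lemma weight_reflected a :
  q ^ (- wt (swap s i) (tperm (lo i) (hi i) a) i) * mu (tperm (lo i) (hi i) a) =
  weight logq s Lam a.
Proof.
rewrite -(qpow_int exp_logq) /wt -(dsg_tau tnth_swap) /weight.
case: tpermP => [->|->|/eqP al /eqP ah].
- rewrite eqxx eq_sym lo_neq_hi reflected_weight_hi /qapow -qpowD; congr qpow.
  by rewrite sub0r mulrN1 opprK; ring.
- rewrite eqxx lo_neq_hi reflected_weight_lo /qapow -qpowD; congr qpow.
  by rewrite subr0 mulr1 rmorphN /=; ring.
rewrite /reflected_weight (negbTE al) (negbTE ah) subr0 mulr0 oppr0.
by rewrite /qapow -qpowD add0r.
Qed.

Lemma reflected_weight_ratio :
  Lam (lo i) + Lam (hi i) != 0 ->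
  normalised_pair logq (Lam (lo i)) (Lam (hi i)) ->
  (mu (lo i) / mu (hi i)) ^+ 2 != 1.
Proof.
move=> Lam0 norm; apply: contra Lam0 => /eqP h; apply/eqP/norm; move: h.
rewrite reflected_weight_lo reflected_weight_hi /qapow -qpowN -qpowD expr2 -qpowD.
set z := (X in qpow logq X); set w := 2 * _.
(* The shifts cancel in the ratio, and d_(i+1) = - d_i turns the difference of the exponents into -
   d_i times their sum. Either sign will do, as inverting preserves 1. *)
suff [->|->] : z = w \/ z = - w; first by [].
  by rewrite qpowN => /(congr1 GRing.inv); rewrite invrK invr1.
rewrite /z /w; move: odd_i; rewrite /dsg.
by case: (tnth s (lo i)); case: (tnth s (hi i)) => // _; [left|right];
  rewrite /= ?expr1 ?expr0 ?rmorphN ?rmorph1; ring.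
Qed.

End Weights.

Theorem proposition3p14 (R : realType) (q logq : R[i])
    (q_neq0 : q != 0) (exp_logq : cexp logq = q)
    (q_not_root : forall k : nat, (0 < k)%N -> q ^+ k != 1)
    (m n : nat) (N_ge2 : (2 <= m + n)%N)
    (s : (m + n).-tuple bool) (s_mn : parity_seq s)
    (i : 'I_(m + n).-1) (s_odd : tnth s (lo i) != tnth s (hi i))
    (Lam : 'I_(m + n) -> R[i])
    (Lam_neq0 : Lam (lo i) + Lam (hi i) != 0)
    (Lam_normalised : normalised_pair logq (Lam (lo i)) (Lam (hi i)))
    (V : lmodType (Uq q s)) (zetaV : V)
    (V_simple : simple_module V)
    (V_weight : highest_weight (weight logq s Lam) zetaV)
    (W : lmodType (Uq q (swap s i))) (zetaW : W)
    (W_simple : simple_module W)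
    (W_weight : highest_weight (reflected_weight logq s i Lam) zetaW) :
  iso_along (normalised_beta q (swap s i) i) V W.
Proof.
have s'_odd := swap_odd s_odd; have ss' := tnth_swap s i.
have q2 : q * q - 1 != 0 by rewrite subr_eq0 -expr2 q_not_root.
pose g x := Upi q s (EGen x); pose g' x := Upi q (swap s i) (EGen x).
have cg : cartan q s g := cartan_gen s q_neq0.
have cg' : cartan q (swap s i) g' := cartan_gen (swap s i) q_neq0.
have far e j : cw (swap s i) i j = 0 ->
    qc (ssign _ (par (swap s i) i) (par (swap s i) j)) (g' (GX e i)) (g' (GX e j)).
  exact: Upi_xx0.
(* The relation reads x_i^2 = - x_i^2, and 2 is invertible in characteristic zero. *)
have sq e : g' (GX e i) * g' (GX e i) = 0.
  have := far e i (cw_ii s'_odd); rewrite (par_i s'_odd) /qc /ssign expr1 scaleN1r.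
  move/eqP; rewrite -addr_eq0 -mulr2n -scaler_nat scaler_eq0 pnatr_eq0 /=.
  by move/eqP.
pose h := refl q (swap s i) i g'.
have ch : cartan q s h := cartan_refl q_neq0 q2 ss' s'_odd cg' sq far.
have hsurj u : exists x, aev h x = u.
  have [x <-] := UpiP u; have [y yE] := refl_surj q_neq0 q2 s'_odd cg' x.
  by exists y.
have hwW := hwvec_refl q_neq0 q2 s'_odd cg' sq (highest_weight_hwvec W_weight)
  (reflected_weight_ratio s_odd Lam_neq0 Lam_normalised).
have {}hwW := hwvec_eq (weight_reflected exp_logq s i Lam) hwW.
have [f [fbij fE]] := hw_iso q_neq0 q_not_root cg (highest_weight_hwvec V_weight)
  (simple_hw_simple (@UpiP _ q _ s) V_simple (hw_neq0 (highest_weight_hwvec V_weight)))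
  ch hwW (simple_hw_simple hsurj W_simple (hw_neq0 hwW)).
exists f; split=> // x v; rewrite UpiE fE Upi_esubst; congr (_ *: _).
by apply: aev_ext => y; rewrite UpiE normalised_betaE.
Qed.
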